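(* Let $\mathcal M$ be a semifinite von Neumann algebra with a normal semifinite faithful trace $tr$, and let $a\in\overline{\mathcal M}$ be a $tr$-measurable operator such that $\mathrm{ord}_\infty(a)=1$. Then $a$ is $\infty$-eccentric.
   Context: $\mathcal M\subset\mathcal B(\mathcal H)$ is a semifinite von Neumann algebra with a normal semifinite faithful trace $tr$. $\overline{\mathcal M}$ denotes the $tr$-measurable operators, i.e. the closed, densely defined operators $x$ on $\mathcal H$ affiliated with $\mathcal M$ such that $tr(e_{|x|}(t,\infty))<\infty$ for some $t>0$, where $e_{|x|}$ is the spectral measure of $|x|$. For $a\in\overline{\mathcal M}$ and $t>0$: $\lambda_a(t):=tr(e_{|a|}(t,\infty))$ is the distribution function and $\mu_a(t):=\inf\{s\ge 0:\lambda_a(s)\le t\}$ is the non-increasing rearrangement of $a$. The order of infinitesimal of $a$ at $\infty$ is $\mathrm{ord}_\infty(a):=\liminf_{t\to\infty}\frac{\log\mu_a(t)}{\log(1/t)}$ (with $\log 0=-\infty$). Set $S^\infty_a(t):=\int_1^t\mu_a(s)\,ds$ if $\mu_a\notin L^1(1,\infty)$, and $S^\infty_a(t):=\int_t^\infty\mu_a(s)\,ds$ if $\mu_a\in L^1(1,\infty)$. The operator $a$ is called $\infty$-eccentric if $1$ is a limit point of $\left\{\frac{S^\infty_a(2t)}{S^\infty_a(t)}\right\}$ when $t\to\infty$, i.e. there is a sequence $t_j\to\infty$ with $S^\infty_a(2t_j)/S^\infty_a(t_j)\to1$. *)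

(* Defs.v *)
From HB Require Import structures.
From mathcomp Require Import all_boot all_order all_algebra.
From mathcomp Require Import complex.
From mathcomp Require Import all_classical all_reals all_analysis.

Set Implicit Arguments.
Unset Strict Implicit.
Unset Printing Implicit Defensive.

Import Order.TTheory GRing.Theory Num.Theory.
Import numFieldNormedType.Exports.

Local Open Scope classical_set_scope.
Local Open Scope complex_scope.
Local Open Scope ring_scope.

Section Operators.
Context {R : realType} {H : completeNormedModType R[i]}.

(* ip is linear in its first argument and conjugate-linear in the second. A
   complex Hilbert space is a Banach space H with an ip inducing its norm. *)
Variable ip : {dot H for Num.conj}.

Definition induces_norm : Prop := forall x : H, `|x| ^+ 2 = ip x x.

Definition bounded_op (T : H -> H) : Prop := linear T /\ continuous T.

Definition adjoint_pair (S T : H -> H) : Prop :=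
  forall x y, ip (S x) y = ip x (T y).

(* The order of R[i] is partial: 0 <= z means that z is real and
   nonnegative. *)
Definition positive_op (T : H -> H) : Prop := forall x, 0 <= ip (T x) x.

Definition le_op (S T : H -> H) : Prop := forall x, ip (S x) x <= ip (T x) x.

Definition orthogonal_projection (P : H -> H) : Prop :=
  [/\ bounded_op P, P \o P = P & adjoint_pair P P].

Definition commutant (A : set (H -> H)) : set (H -> H) :=
  [set S | bounded_op S /\ forall T, A T -> S \o T = T \o S].

Definition von_neumann_algebra (M : set (H -> H)) : Prop :=
  (forall S T, M S -> adjoint_pair S T -> M T) /\
  commutant (commutant M) = M.

Definition positive_part (M : set (H -> H)) : set (H -> H) :=
  [set T | M T /\ positive_op T].

Definition directed_op (D : set (H -> H)) : Prop :=
  D !=set0 /\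
  forall S T, D S -> D T -> exists U, [/\ D U, le_op S U & le_op T U].

Definition is_lub_op (M D : set (H -> H)) (T : H -> H) : Prop :=
  [/\ positive_part M T, (forall S, D S -> le_op S T) &
      forall U, positive_part M U -> (forall S, D S -> le_op S U) ->
        le_op T U].

(* tr is a function from the positive part of M to [0, +oo]; its values
   elsewhere are irrelevant. *)
Record nsf_trace (M : set (H -> H)) (tr : (H -> H) -> \bar R) : Prop := {
  trace_ge0 : forall T, positive_part M T -> (0 <= tr T)%E;
  traceD : forall S T, positive_part M S -> positive_part M T ->
    tr (S + T) = (tr S + tr T)%E;
  traceZ : forall (c : R) T, 0 <= c -> positive_part M T ->
    tr (c%:C *: T) = (c%:E * tr T)%E;
  trace_comm : forall S T, M S -> adjoint_pair S T ->
    tr (T \o S) = tr (S \o T);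
  trace_faithful : forall T, positive_part M T -> tr T = 0%E -> T = 0;
  trace_normal : forall D T, D `<=` positive_part M -> directed_op D ->
    is_lub_op M D T -> tr T = ereal_sup (tr @` D);
  trace_semifinite : forall T, positive_part M T -> T <> 0 ->
    exists S, [/\ positive_part M S, S <> 0, le_op S T & (tr S < +oo)%E] }.

(* An unbounded operator is represented by its graph; equality of operators,
   domains included, is then equality of sets. *)
Definition linear_graph (a : set (H * H)) : Prop :=
  [/\ a (0, 0),
      (forall (c : R[i]) p q, a p -> a q -> a (c *: p + q)) &
      forall x y z, a (x, y) -> a (x, z) -> y = z].

Definition dom (a : set (H * H)) : set H := [set x | exists y, a (x, y)].

Definition adjoint (a : set (H * H)) : set (H * H) :=
  [set p | forall q, a q -> ip q.2 p.1 = ip q.1 p.2].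

Definition selfadjoint (T : set (H * H)) : Prop :=
  [/\ linear_graph T, dense (dom T) & adjoint T = T].

(* T = |a|, the positive square root of a^* a. In (B \; A)%relation the relation
   A comes first: (adjoint a \; a) is the graph of x |-> a^* (a x). *)
Definition is_absolute_value (a T : set (H * H)) : Prop :=
  [/\ selfadjoint T, (forall p, T p -> 0 <= ip p.2 p.1) &
      (T \; T = adjoint a \; a)%relation].

Definition scalar_measure (E : set R -> H -> H) (x : H)
    (nu : {measure set R -> \bar R}) : Prop :=
  forall B, measurable B -> nu B = (complex.Re (ip (E B x) x))%:E.

Definition projection_valued_measure (E : set R -> H -> H) : Prop :=
  [/\ (forall B, measurable B -> orthogonal_projection (E B)),
      E setT = id,
      (forall B C, measurable B -> measurable C ->
         E (B `&` C) = E B \o E C) &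
      forall x, exists nu, scalar_measure E x nu].

(* E resolves the self-adjoint operator T, i.e. T is the integral of lambda
   dE(lambda). The quadratic form on the domain determines T, by
   polarization. *)
Definition spectral_resolution (T : set (H * H)) (E : set R -> H -> H) : Prop :=
  projection_valued_measure E /\
  forall x (nu : {measure set R -> \bar R}), scalar_measure E x nu ->
    (dom T x <-> (\int[nu]_l (l ^+ 2)%:E < +oo)%E) /\
    (forall y, T (x, y) -> ip y x = (\int[nu]_l l)%:C).

(* e_{|a|}. By the spectral theorem it exists, and is unique on Borel sets, for
   every closed densely defined a; the default value plays no role there. *)
Definition abs_spectral_measure (a : set (H * H)) : set R -> H -> H :=
  xget (fun _ _ => 0)
    [set E | exists T, is_absolute_value a T /\ spectral_resolution T E].

(* T' a is contained in a T' for every T' in the commutant of M. *)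
Definition affiliated (M : set (H -> H)) (a : set (H * H)) : Prop :=
  forall T, commutant M T -> forall x y, a (x, y) -> a (T x, T y).

Variable tr : (H -> H) -> \bar R.

Definition distribution_function (a : set (H * H)) (t : R) : \bar R :=
  tr (abs_spectral_measure a `]t, +oo[%classic).

Definition trace_measurable (M : set (H -> H)) (a : set (H * H)) : Prop :=
  [/\ linear_graph a, dense (dom a), closed a, affiliated M a &
      exists2 t : R, 0 < t & (distribution_function a t < +oo)%E].

Definition rearrangement (a : set (H * H)) (t : R) : \bar R :=
  ereal_inf [set s%:E | s in
    [set s : R | 0 <= s /\ (distribution_function a s <= t%:E)%E]].

Definition ord_infty (a : set (H * H)) : \bar R :=
  limf_einf (fun t : R => lne (rearrangement a t) / (ln (1 / t))%:E)%E
    (pinfty_nbhs R).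

Definition S_infty (a : set (H * H)) (t : R) : \bar R :=
  if pselect ((@lebesgue_measure R).-integrable `]1, +oo[ (rearrangement a)) then
    (\int[@lebesgue_measure R]_(s in `[t, +oo[) rearrangement a s)%E
  else (\int[@lebesgue_measure R]_(s in `[1%R, t]) rearrangement a s)%E.

Definition infty_eccentric (a : set (H * H)) : Prop :=
  exists2 t : nat -> R, t @ \oo --> +oo &
    (fun j => S_infty a (2 * t j) / S_infty a (t j))%E @ \oo --> 1%E.

End Operators.

(* Main.v *)
Require Import Defs.
From HB Require Import structures.
From mathcomp Require Import all_boot all_order all_algebra.
From mathcomp Require Import complex.
From mathcomp Require Import all_classical all_reals all_analysis.
From mathcomp Require Import measurable_realfun ring lra.

Set Implicit Arguments.
Unset Strict Implicit.
Unset Printing Implicit Defensive.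

Import Order.TTheory GRing.Theory Num.Theory.
Import numFieldNormedType.Exports.

Local Open Scope classical_set_scope.
Local Open Scope complex_scope.
Local Open Scope ring_scope.

(** Write mu for the rearrangement of a and S for the function whose doubling
    ratio S (2 t) / S t must accumulate at 1.

    Analysis.  mu is non-increasing, so an integral of mu over [t, 2 t] lies
    between t mu(2 t) and t mu(t).  If the ratio stayed away from 1, iterating
    the doubling t -> 2 t would force S to grow, resp. decay, at least like a
    power t^alpha, resp. t^(-alpha), with alpha > 0.
    - When mu is not integrable, S (2 t) - S t <= t mu(t) then gives
      t mu(t) >= c t^alpha, whereas ord = 1 gives t mu(t) <= t^eps eventually,
      for every eps > 0 (doubling_increasing).
    - When mu is integrable, t mu(2 t) <= S t then gives
      t mu(t) <= C t^(-alpha), whereas ord = 1 gives t mu(t) >= t^(-eps) for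
      arbitrarily large t (doubling_decreasing).

    Operators.  The analysis needs S to take finite nonzero values.  That mu does
    not vanish follows from ord = 1, but it must also be shown that mu(1) is
    finite, that is, that the trace of the spectral projection E(]s, oo[) of |a|
    is at most 1 for some s.  Since this trace is finite for one s > 0, normality of the trace makes
    it tend to 0 as s grows, as soon as these projections belong to M
    (trace_tail).  By the bicommutant property this means that E(]t, oo[)
    commutes with every U in the commutant of M.  Such a U has an adjoint
    (Riesz), also in the commutant, hence it commutes with a^* a = |a|^2.
    Comparing the growth of |a|^(2 k) on the range of E(]-oo, t]), where it is
    at most t^(2 k), and on the range of E([s, oo[), where it is at least
    s^(2 k), shows that E([s, oo[) U E(]-oo, t]) = 0 for t < s; let s decrease
    to t, and do the same for the adjoint of U (spectral_growth, spectral_cut).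

    All norm computations take place in the real Hilbert space underlying H,
    with inner product Re <x, y>, so that they are real (in)equalities. *)

(** * The underlying real Hilbert space *)

Section ComplexParts.
Context {R : realType}.
Implicit Types z w : R[i].

Lemma ReD z w : complex.Re (z + w) = complex.Re z + complex.Re w.
Proof. by case: z; case: w. Qed.

Lemma ReN z : complex.Re (- z) = - complex.Re z.
Proof. by case: z. Qed.

Lemma ReZ (c : R) z : complex.Re (c%:C * z) = c * complex.Re z.
Proof. by case: z => a b /=; rewrite mul0r subr0. Qed.

Lemma ReZi z : complex.Re ('i * z) = - complex.Im z.
Proof. by case: z => a b /=; rewrite mul0r mul1r sub0r. Qed.

End ComplexParts.

Section Hilbert.
Context {R : realType} {H : completeNormedModType R[i]}.
Variable ip : {dot H for Num.conj}.

Definition real_ip (x y : H) : R := complex.Re (ip x y).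
Definition sqnorm (x : H) : R := real_ip x x.

Local Notation rip := real_ip.
Local Notation sqn := sqnorm.

Lemma ipC x y : ip y x = (ip x y)^*.
Proof. by rewrite hermC expr0 mul1r. Qed.

Lemma ripC x y : rip x y = rip y x.
Proof. by rewrite /real_ip (ipC x y); case: (ip x y). Qed.

Lemma ripDl x y z : rip (x + y) z = rip x z + rip y z.
Proof. by rewrite /real_ip linearDl /= ReD. Qed.

Lemma ripZl (c : R) x z : rip (c%:C *: x) z = c * rip x z.
Proof. by rewrite /real_ip linearZl_LR /= ReZ. Qed.

Lemma ripDr x y z : rip z (x + y) = rip z x + rip z y.
Proof. by rewrite !(ripC z) ripDl. Qed.

Lemma ripZr (c : R) x z : rip z (c%:C *: x) = c * rip z x.
Proof. by rewrite !(ripC z) ripZl. Qed.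

Lemma ripNl x z : rip (- x) z = - rip x z.
Proof. by rewrite /real_ip linearNl /= ReN. Qed.

Lemma ripNr x z : rip z (- x) = - rip z x.
Proof. by rewrite !(ripC z) ripNl. Qed.

Lemma rip0l z : rip 0 z = 0.
Proof. by rewrite /real_ip linear0l. Qed.

Definition ripE := (ripDl, ripDr, ripNl, ripNr, ripZl, ripZr).

Lemma rip_im x y : rip ('i *: x) y = - complex.Im (ip x y).
Proof. by rewrite /real_ip linearZl_LR /= ReZi. Qed.

Lemma ipE x y : ip x y = (rip x y) +i* (- rip ('i *: x) y).
Proof. by rewrite rip_im opprK /real_ip; case: (ip x y). Qed.

Lemma ip_sqn x : ip x x = (sqn x)%:C.
Proof.
rewrite /sqnorm /real_ip; have := dnorm_ge0 ip x.
by case: (ip x x) => a b; rewrite lecE /= => /andP[/eqP -> _].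
Qed.

Lemma sqn_ge0 x : 0 <= sqn x.
Proof. by have := dnorm_ge0 ip x; rewrite ip_sqn -[0]/(0%:C) lecR. Qed.

Lemma sqn_eq0 x : sqn x = 0 -> x = 0.
Proof.
by move=> h; apply/eqP; rewrite -(dnorm_eq0 ip) ip_sqn h.
Qed.

Lemma sqn0 : sqn 0 = 0. Proof. exact: rip0l. Qed.

Lemma sqnD x y : sqn (x + y) = sqn x + sqn y + 2 * rip x y.
Proof. by rewrite /sqnorm !ripE (ripC y x); lra. Qed.

Lemma sqnB x y : sqn (x - y) = sqn x + sqn y - 2 * rip x y.
Proof. by rewrite sqnD {2}/sqnorm !ripE; rewrite -/(sqn y); lra. Qed.

Lemma sqnZ (c : R) x : sqn (c%:C *: x) = c ^+ 2 * sqn x.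
Proof. by rewrite /sqnorm !ripE mulrA. Qed.

Lemma rip_CS x y : rip x y ^+ 2 <= sqn x * sqn y.
Proof.
have [y0|y0] := eqVneq (sqn y) 0.
  by rewrite (sqn_eq0 y0) ripC rip0l expr0n /= sqn0 mulr0.
have yp : 0 < sqn y by rewrite lt_def y0 sqn_ge0.
have := sqn_ge0 ((sqn y)%:C *: x - (rip x y)%:C *: y).
rewrite sqnB !sqnZ !ripE.
have -> : sqn y ^+ 2 * sqn x + rip x y ^+ 2 * sqn y
   - 2 * (sqn y * (rip x y * rip x y)) = sqn y * (sqn x * sqn y - rip x y ^+ 2).
  by ring.
by rewrite pmulr_rge0 // subr_ge0.
Qed.

Lemma rip_inj x y : (forall z, rip z x = rip z y) -> x = y.
Proof.
move=> h; apply/eqP; rewrite -subr_eq0; apply/eqP/sqn_eq0.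
by rewrite /sqnorm ripDr ripNr h subrr.
Qed.

Hypothesis hip : induces_norm ip.

Lemma normE x : `|x| = (Num.sqrt (sqn x))%:C.
Proof.
apply/eqP; rewrite -(@eqrXn2 _ 2%N) // ?lecR ?sqrtr_ge0 //.
by rewrite -rmorphXn /= sqr_sqrtr ?sqn_ge0 // hip ip_sqn.
Qed.

Lemma norm_ltE x (e : R) : 0 < e -> (`|x| < e%:C) = (sqn x < e ^+ 2).
Proof.
move=> e0; rewrite normE ltcR -(ltr_pXn2r (n:=2)) //.
- by rewrite sqr_sqrtr // sqn_ge0.
- exact: sqrtr_ge0.
- exact: ltW.
Qed.

(** Completeness of H for the real squared norm, in place of filters and of balls
    with complex radii. *)
Lemma complete_sqn (u : nat -> H) :
  (forall e : R, 0 < e -> exists n0, forall n m, (n0 <= n)%N -> (n0 <= m)%N ->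
     sqn (u n - u m) < e) ->
  exists z, forall e : R, 0 < e -> exists n0, forall n, (n0 <= n)%N ->
     sqn (u n - z) < e.
Proof.
move=> hu.
have reale (e : R[i]) : 0 < e -> exists2 r : R, 0 < r & e = r%:C.
  case: e => a b; rewrite ltcE /= => /andP[/eqP -> a0]; by exists a.
have /cauchy_cvg cu : cauchy (u @ \oo).
  apply: cauchy_exP => e /reale[r r0 ->].
  have [n0 hn0] := hu (r ^+ 2) (exprn_gt0 _ r0).
  exists (u n0); exists n0 => // n /= hn.
  by rewrite -ball_normE /= norm_ltE // hn0.
exists (lim (u @ \oo)) => e e0.
have se : 0 < Num.sqrt e by rewrite sqrtr_gt0.
have := cu _ (nbhsx_ballx (lim (u @ \oo)) (Num.sqrt e)%:C _).
rewrite ltcR => /(_ se) [n0 _ hn0]; exists n0 => n hn.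
have /= := hn0 n hn; rewrite -ball_normE /= norm_ltE // sqr_sqrtr ?ltW //.
by rewrite sqnB [sqn (u n - _)]sqnB ripC [sqn (lim _) + _]addrC.
Qed.

(** A vector v of D nearer to x than 0 is cannot be orthogonal to x, as then
    |x - v|^2 = |x|^2 + |v|^2. *)
Lemma dense_orth (D : set H) x : dense D -> (forall v, D v -> rip x v = 0) -> x = 0.
Proof.
move=> dD xD; apply: sqn_eq0; apply/eqP/negP => /negP x0.
have xp : 0 < sqn x by rewrite lt_def x0 sqn_ge0.
have se : 0 < Num.sqrt (sqn x) by rewrite sqrtr_gt0.
have := dD (ball x (Num.sqrt (sqn x))%:C) _ (ball_open _ _).
case; first by exists x; apply: ballxx; rewrite ltcR.
move=> v [+ Dv]; rewrite -ball_normE /= norm_ltE // sqr_sqrtr ?ltW //.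
by rewrite sqnB xD // ; have := sqn_ge0 v; lra.
Qed.

Definition sqn_bounded (S : H -> H) :=
  exists2 C : R, 0 <= C & forall x, sqn (S x) <= C * sqn x.

Lemma linear_real_bound (V : normedModType R[i]) (f : H -> V) :
  linear f -> continuous f ->
  exists2 C : R, 0 <= C & forall x, `|f x| <= (C * Num.sqrt (sqn x))%:C.
Proof.
move=> lf cf.
pose F := GRing.isLinear.Build _ _ _ _ f lf.
pose g : {linear H -> V} := HB.pack f F.
have /linear_boundedP : bounded_near g (nbhs (0 : H)).
  by apply/linear_bounded_continuous.
case=> M [Mr hM].
have := hM (`|M| + 1).
rewrite (le_lt_trans (real_ler_norm Mr)) ?ltrDl ?ltr01 // => /(_ isT) h.
move: (h); have : 0 <= `|M| + 1 by rewrite addr_ge0.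
case: (`|M| + 1) => c d; rewrite lecE /= => /andP[/eqP -> c0] {}h.
exists c => // x; have := h x; rewrite normE rmorphM /= //.
Qed.

Lemma bounded_op_sqn S : bounded_op S -> sqn_bounded S.
Proof.
move=> [lS cS]; have [C C0 h] := linear_real_bound lS cS.
exists (C ^+ 2) => [|x]; first by rewrite exprn_ge0.
have := h x; rewrite normE lecR -(ler_pXn2r (n:=2)) //.
- by rewrite exprMn !sqr_sqrtr // sqn_ge0.
- exact: sqrtr_ge0.
- by rewrite nnegrE mulr_ge0 // sqrtr_ge0.
Qed.

Lemma sqn_bounded_op S : linear S -> sqn_bounded S -> bounded_op S.
Proof.
move=> lS [C C0 hC]; split => //.
pose F := GRing.isLinear.Build _ _ _ _ S lS.
pose g : {linear H -> H} := HB.pack S F.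
apply: (@bounded_linear_continuous _ _ _ g).
apply/linear_boundedP; exists (Num.sqrt C)%:C.
split; first by rewrite complex_real.
move=> e he x; apply: le_trans (_ : (Num.sqrt C)%:C * `|x| <= _); last first.
  by rewrite ler_wpM2r // ltW.
rewrite !normE -rmorphM /= lecR -sqrtrM // ler_sqrt //.
by rewrite mulr_ge0 // sqn_ge0.
Qed.

Lemma bounded_op0 S : bounded_op S -> S 0 = 0 :> H.
Proof.
move=> [lS _]; have := lS 1 0 0; rewrite !scale1r addr0 => h.
by apply: (addrI (S 0)); rewrite -h addr0.
Qed.

Lemma bounded_opD S x y : bounded_op S -> S (x + y) = S x + S y :> H.
Proof. by move=> [lS _]; have := lS 1 x y; rewrite !scale1r. Qed.

Lemma bounded_opZ S c x : bounded_op S -> S (c *: x) = c *: S x :> H.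
Proof.
move=> bS; have [lS _] := bS; have := lS c x 0.
by rewrite !addr0 bounded_op0 // addr0.
Qed.

Lemma bounded_opB S x y : bounded_op S -> S (x - y) = S x - S y :> H.
Proof.
by move=> bS; rewrite -scaleN1r bounded_opD // bounded_opZ // scaleN1r.
Qed.

End Hilbert.

(** * Adjoints of bounded operators *)

Section Adjoints.
Context {R : realType} {H : completeNormedModType R[i]}.
Variable ip : {dot H for Num.conj}.
Hypothesis hip : induces_norm ip.

Local Notation rip := (real_ip ip).
Local Notation sqn := (sqnorm ip).

Lemma eq0_small_sqr (a K : R) : 0 <= K ->
  (forall e : R, 0 < e -> a ^+ 2 <= e * K) -> a = 0.
Proof.
move=> K0 h; apply/eqP; rewrite -sqrf_eq0 eq_le sqr_ge0 andbT.
apply/ler_addgt0Pr => e e0; rewrite add0r.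
have := h (e / (K + 1)); rewrite divr_gt0 ?ltr_wpDl // => /(_ isT) h1.
apply: (le_trans h1); rewrite mulrAC ler_pdivrMr ?ltr_wpDl //.
by rewrite ler_wpM2l ?lerDl // ltW.
Qed.

(** A minimizer z of J x = |x|^2 - 2 g x satisfies rip x z = g x because the
    derivative of J at z vanishes.  Minimizing sequences are Cauchy by the
    parallelogram identity.  The first-order condition is read off from the
    near-minimizers and passed to the limit, which avoids the continuity of J
    and g. *)
Lemma riesz (g : H -> R) : {morph g : x y / x + y} ->
  (forall (c : R) x, g (c%:C *: x) = c * g x) ->
  (exists2 C : R, 0 <= C & forall x, g x ^+ 2 <= C * sqn x) ->
  exists z, forall x, g x = rip x z.
Proof.
move=> gD gZ [C C0 gC].
pose J x := sqn x - 2 * g x.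
have JC x : - C <= J x.
  have h := gC x; have N0 := sqn_ge0 ip x; rewrite /J.
  rewrite lerBrDr addrC -lerBrDr opprK leNgt; apply/negP => lt.
  have : (sqn x + C) ^+ 2 < (2 * g x) ^+ 2.
    rewrite ltr_pXn2r // nnegrE ?addr_ge0 // ltW // (le_lt_trans _ lt) //.
    by rewrite addr_ge0.
  have := sqr_ge0 (sqn x - C); nra.
have hJ : has_inf (range J).
  by split; [exists (J 0), 0 | exists (- C) => _ [x _ <-]].
pose m := inf (range J).
have mJ x : m <= J x by apply: ge_inf; [exact: hJ.2 | exists x].
have /choice[u hu] : forall n, exists x, J x < m + n.+1%:R^-1.
  move=> n; have n0 : 0 < n.+1%:R^-1 :> R by rewrite invr_gt0.
  by have [_ [x _ <-] ?] := inf_adherent n0 hJ; exists x.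
have small (e : R) : 0 < e -> exists n0, forall n, (n0 <= n)%N -> J (u n) < m + e.
  move=> e0; have [n0 _ hn0] := near_infty_natSinv_lt (PosNum e0).
  by exists n0 => n hn; apply: (lt_trans (hu n)); rewrite ltrD2l; exact: hn0.
have par x y : sqn (x - y) = 2 * J x + 2 * J y - 4 * J ((2^-1)%:C *: (x + y)).
  rewrite /J sqnB sqnZ gZ sqnD gD; lra.
have [z hz] : exists z, forall e : R, 0 < e -> exists n0, forall n, (n0 <= n)%N ->
     sqn (u n - z) < e.
  apply: complete_sqn => // e e0.
  have [n0 hn0] := small (e / 4) (divr_gt0 e0 (ltr0n _ 4)).
  exists n0 => n k hn hk; rewrite par.
  have := mJ ((2^-1)%:C *: (u n + u k)); have := hn0 _ hn; have := hn0 _ hk; lra.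
exists z => w; apply/eqP; rewrite -subr_eq0; apply/eqP.
apply: (@eq0_small_sqr _ (4 * sqn w)) => [|e e0].
  by rewrite mulr_ge0 // sqn_ge0.
have [n1 h1] := small e e0; have [n2 h2] := hz e e0.
pose x := u (maxn n1 n2).
have {}h1 : J x < m + e by apply: h1; rewrite leq_maxl.
have {}h2 : sqn (x - z) < e by apply: h2; rewrite leq_maxr.
have d1 : (g w - rip w x) ^+ 2 <= e * sqn w.
  have Jt t : 0 <= e - 2 * t * (g w - rip w x) + t ^+ 2 * sqn w.
    have := mJ (x + t%:C *: w); rewrite /J sqnD sqnZ gD gZ ripZr ripC.
    move: h1; rewrite /J; lra.
  (* minimize the quadratic Jt over t *)
  have [w0|w0] := eqVneq (sqn w) 0.
    have -> : w = 0 by exact: sqn_eq0 w0.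
    have := gZ 0 0; rewrite scaler0 mul0r rip0l => ->.
    by rewrite subrr sqn0 expr0n mulr0.
  have wp : 0 < sqn w by rewrite lt_def w0 sqn_ge0.
  have := Jt ((g w - rip w x) / sqn w).
  rewrite -(pmulr_lge0 _ wp); set d := g w - _.
  have -> : (e - 2 * (d / sqn w) * d + (d / sqn w) ^+ 2 * sqn w) * sqn w
     = e * sqn w - d ^+ 2 by field.
  by rewrite subr_ge0.
have d2 : rip w (x - z) ^+ 2 <= e * sqn w.
  apply: (le_trans (rip_CS ip _ _)); rewrite mulrC ler_wpM2r ?sqn_ge0 //.
  exact: ltW.
have -> : g w - rip w z = (g w - rip w x) + rip w (x - z).
  by rewrite ripDr ripNr; ring.
move: d1 d2; move: (g w - rip w x) (rip w (x - z)) => a b d1 d2.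
have := sqr_ge0 (a - b); nra.
Qed.

Lemma ip_rip_inj x y : (forall z, ip z x = ip z y) -> x = y.
Proof. by move=> h; apply: (@rip_inj _ _ ip) => z; rewrite /real_ip h. Qed.

Lemma adjoint_exists S : bounded_op S ->
  exists2 T, bounded_op T & adjoint_pair ip S T.
Proof.
move=> bS; have [C C0 hC] := bounded_op_sqn hip bS.
have SD x y := bounded_opD x y bS; have SZ c x := bounded_opZ c x bS.
have /choice[T hT] : forall y, exists z, forall x, rip (S x) y = rip x z.
  move=> y; apply: riesz => [x x'|c x|]; first by rewrite SD ripDl.
    by rewrite SZ ripZl.
  exists (C * sqn y) => [|x]; first by rewrite mulr_ge0 // sqn_ge0.
  apply: (le_trans (rip_CS ip _ _)); rewrite mulrAC ler_wpM2r ?sqn_ge0 //.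
have ad : adjoint_pair ip S T.
  by move=> x y; rewrite !ipE -SZ !hT.
exists T => //; apply: sqn_bounded_op => //.
  move=> c y y'; apply: ip_rip_inj => z.
  by rewrite -ad !linearDr /= !linearZr_LR /= !ad.
exists C => // y.
have [->|y0] := eqVneq (sqn (T y)) 0; first by rewrite mulr_ge0 // sqn_ge0.
have yp : 0 < sqn (T y) by rewrite lt_def y0 sqn_ge0.
rewrite -(ler_pM2l yp); apply: le_trans (_ : sqn (S (T y)) * sqn y <= _).
  by rewrite -expr2 {1}/sqnorm -hT rip_CS.
by rewrite mulrA ler_wpM2r ?sqn_ge0 // mulrC hC.
Qed.

End Adjoints.

(** * Projection-valued measures *)

Section ProjectionValuedMeasures.
Context {R : realType} {H : completeNormedModType R[i]}.
Variable ip : {dot H for Num.conj}.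
Variable E : set R -> H -> H.
Hypothesis hE : projection_valued_measure ip E.

Local Notation rip := (real_ip ip).
Local Notation sqn := (sqnorm ip).

Lemma pvm_bounded B : measurable B -> bounded_op (E B).
Proof. by case: hE => h _ _ _ /h[]. Qed.

Lemma pvm_ip B x y : measurable B -> ip (E B x) y = ip x (E B y).
Proof. by case: hE => h _ _ _ /h[]. Qed.

Lemma pvm_rip B x y : measurable B -> rip (E B x) y = rip x (E B y).
Proof. by move=> mB; rewrite /real_ip pvm_ip. Qed.

Lemma pvmI B C x : measurable B -> measurable C -> E (B `&` C) x = E B (E C x).
Proof. by case: hE => _ _ h _ mB mC; rewrite h. Qed.

Lemma pvmK B x : measurable B -> E B (E B x) = E B x.
Proof. by move=> mB; rewrite -pvmI // setIid. Qed.

Lemma pvmT x : E setT x = x.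
Proof. by case: hE => _ -> _ _. Qed.

Lemma rip_pvm B x : measurable B -> rip (E B x) x = sqn (E B x).
Proof. by move=> mB; rewrite -{1}pvmK // pvm_rip. Qed.

(** The scalar measure of x is B |-> |E(B) x|^2: all limits of projections below
    are taken through it. *)
Lemma scalar_measureP x (nu : {measure set R -> \bar R}) :
  scalar_measure ip E x nu <-> forall B, measurable B -> nu B = (sqn (E B x))%:E.
Proof. by split => h B mB; rewrite h // -rip_pvm. Qed.

Lemma scalar_measure_ex x : exists nu, scalar_measure ip E x nu.
Proof. by case: hE. Qed.

Lemma pvm0 x : E set0 x = 0.
Proof.
have [nu /scalar_measureP h] := scalar_measure_ex x.
apply: (@sqn_eq0 _ _ ip); have := h _ measurable0.
by rewrite measure0 => -[].
Qed.

(** Additivity of E comes from that of the scalar measures, applied to the vector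
    r = E(A U B) x - E(A) x - E(B) x itself: r lies in the range of E(A U B)
    and is killed by E(A) and E(B). *)
Lemma pvmU A B x : measurable A -> measurable B -> A `&` B = set0 ->
  E (A `|` B) x = E A x + E B x.
Proof.
move=> mA mB AB; have mU := measurableU _ _ mA mB.
apply/eqP; rewrite -subr_eq0; apply/eqP.
set r := (X in X = 0).
have bA := pvm_bounded mA; have bB := pvm_bounded mB; have bU := pvm_bounded mU.
have rU : E (A `|` B) r = r.
  rewrite /r bounded_opB // bounded_opD // -!pvmI // setIid.
  by rewrite (setIidr (@subsetUl _ _ _)) (setIidr (@subsetUr _ _ _)).
have rA : E A r = 0.
  rewrite /r bounded_opB // bounded_opD // -!pvmI // setIid AB pvm0 addr0.
  by rewrite (setIidl (@subsetUl _ _ _)) subrr.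
have rB : E B r = 0.
  rewrite /r bounded_opB // bounded_opD // -!pvmI // setIid (setIC B A).
  by rewrite AB pvm0 add0r (setIidl (@subsetUr _ _ _)) subrr.
have [nu /scalar_measureP h] := scalar_measure_ex r.
apply: (@sqn_eq0 _ _ ip); have : nu (A `|` B) = (nu A + nu B)%E by exact: measureU.
by rewrite !h // rA rB rU sqn0 adde0 => -[].
Qed.

Lemma pvmCx B x : measurable B -> x = E B x + E (~` B) x.
Proof.
move=> mB; rewrite -pvmU //; first by rewrite setUv pvmT.
- exact: measurableC.
- by rewrite setICr.
Qed.

Lemma sqn_pvmB A B x : measurable A -> measurable B -> A `<=` B ->
  sqn (E B x - E A x) = sqn (E B x) - sqn (E A x).
Proof.
move=> mA mB AB; rewrite sqnB pvm_rip // -pvmI //.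
by rewrite setIC (setIidl AB) ripC rip_pvm //; ring.
Qed.

Lemma sqn_pvm_le B x : measurable B -> sqn (E B x) <= sqn x.
Proof.
move=> mB; rewrite -subr_ge0 -{1}(pvmT x) -sqn_pvmB //.
exact: sqn_ge0.
Qed.

(** Strong continuity from below. *)
Lemma pvm_bigcup (F : nat -> set R) x (e : R) : (forall n, measurable (F n)) ->
  nondecreasing_seq F -> 0 < e ->
  exists n, sqn (E (\bigcup_n F n) x - E (F n) x) < e.
Proof.
move=> mF ndF e0.
have mU : measurable (\bigcup_n F n) by exact: bigcup_measurable.
have [nu /scalar_measureP h] := scalar_measure_ex x.
have := nondecreasing_cvg_mu mF mU ndF (mu := nu).
rewrite h // => /fine_cvgP[_].
move=> /cvgrPdist_lt /(_ e e0)[n _ hn]; exists n.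
rewrite sqn_pvmB //; last exact: bigcup_sup.
apply: le_lt_trans (hn n (leqnn n)) => /=.
by rewrite h //= ler_norm.
Qed.

End ProjectionValuedMeasures.

(** * The self-adjoint operator resolved by a projection-valued measure *)

Section SpectralResolution.
Context {R : realType} {H : completeNormedModType R[i]}.
Variable ip : {dot H for Num.conj}.
Hypothesis hip : induces_norm ip.
Variables (T : set (H * H)) (E : set R -> H -> H).
Hypothesis saT : selfadjoint ip T.
Hypothesis hTE : spectral_resolution ip T E.

Local Notation rip := (real_ip ip).
Local Notation sqn := (sqnorm ip).

Let hE : projection_valued_measure ip E. Proof. by case: hTE. Qed.

Lemma graphD p q : T p -> T q -> T (p + q).
Proof. by case: saT => -[_ lT _] _ _ Tp Tq; rewrite -[p]scale1r; exact: lT. Qed.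

Lemma graphZ c p : T p -> T (c *: p).
Proof. by case: saT => -[T0 lT _] _ _ Tp; rewrite -[_ *: _]addr0; exact: lT. Qed.

Lemma graph_fun x y z : T (x, y) -> T (x, z) -> y = z.
Proof. by case: saT => -[_ _ fT] _ _; exact: fT. Qed.

Lemma graph_sym x y x' y' : T (x, y) -> T (x', y') -> rip y x' = rip x y'.
Proof.
case: saT => _ _ aT Txy Txy'; rewrite -aT in Txy'.
by have := Txy' _ Txy; rewrite /real_ip /= => ->.
Qed.

Lemma dom_intgl x nu : scalar_measure ip E x nu ->
  dom T x <-> (\int[nu]_l (l ^+ 2)%:E < +oo)%E.
Proof. by move=> h; case: hTE => _ /(_ x nu h)[]. Qed.

Lemma graph_rip x y nu : scalar_measure ip E x nu -> T (x, y) ->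
  rip y x = \int[nu]_l l.
Proof.
by move=> h Txy; case: hTE => _ /(_ x nu h)[_ hh]; rewrite /real_ip hh.
Qed.

Let measurable_sqr (D : set R) : measurable_fun D (EFin \o (fun l : R => l ^+ 2)).
Proof. by apply/measurable_EFinP; exact: measurable_funX. Qed.

Let sqr_ge0E (l : R) : (0 <= (l ^+ 2)%:E)%E.
Proof. by rewrite lee_fin sqr_ge0. Qed.

Lemma scalar_measure_setT x nu : scalar_measure ip E x nu -> nu setT = (sqn x)%:E.
Proof. by move=> /(scalar_measureP hE)->//; rewrite (pvmT hE). Qed.

(** The cross terms <E(C) u, E(C) v> vanish since u and v lie in the ranges of
    complementary projections. *)
Lemma scalar_measure_add B u v (nu nu' : {measure set R -> \bar R}) :
  measurable B -> E B u = u -> E B v = 0 ->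
  scalar_measure ip E u nu -> scalar_measure ip E v nu' ->
  scalar_measure ip E (u + v) (measure_add nu nu').
Proof.
move=> mB uB vB /(scalar_measureP hE) hu /(scalar_measureP hE) hv.
apply/(scalar_measureP hE) => C mC.
rewrite /measure_add /= /msum 2!big_ord_recl big_ord0 /= adde0.
rewrite hu // hv // (bounded_opD _ _ (pvm_bounded hE mC)) sqnD.
rewrite (pvm_rip hE) // -(pvmI hE) // setIid -[in rip u _]uB (pvm_rip hE) //.
rewrite -(pvmI hE) // setIC (pvmI hE) // vB (bounded_op0 (pvm_bounded hE mC)).
by rewrite ripC rip0l mulr0 addr0.
Qed.

(** The scalar measure of x is the sum of those of E(B) x and of its complement
    part, so the second moment of the former is the smaller one. *)
Lemma dom_pvm B x : measurable B -> dom T x -> dom T (E B x).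
Proof.
move=> mB; have mC := measurableC mB.
have [nu hu] := scalar_measure_ex hE (E B x).
have [nu' hv] := scalar_measure_ex hE (E (~` B) x).
have := scalar_measure_add mB (pvmK hE _ mB) _ hu hv.
rewrite -(pvmI hE) // setICr (pvm0 hE) => /(_ erefl).
rewrite -(pvmCx hE) // => /dom_intgl -> .
rewrite ge0_integral_measure_add // => h.
apply/(dom_intgl hu); apply: le_lt_trans h.
by rewrite leeDl // integral_ge0.
Qed.

(** Scalar measures are finite and |l| <= 1 + l^2. *)
Lemma integrable_id x nu : scalar_measure ip E x nu -> dom T x ->
  nu.-integrable setT (fun l : R => l%:E).
Proof.
move=> hnu /(dom_intgl hnu) h.
have i1 : nu.-integrable setT (fun l : R => (1 + l ^+ 2)%:E).
  apply/integrableP; split.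
    apply/measurable_EFinP; apply: measurable_funD => //; exact: measurable_funX.
  under eq_integral => l _ do rewrite gee0_abs ?lee_fin ?addr_ge0 ?sqr_ge0 // EFinD.
  rewrite (@ge0_integralD _ _ _ nu _ measurableT (cst 1%E)
    (fun l => (l ^+ 2)%:E)) //.
  rewrite lte_add_pinfty // integral_cst // mul1e (scalar_measure_setT hnu) ltry //.
apply: (le_integrable measurableT _ _ i1) => [|l _].
  by apply/measurable_EFinP.
rewrite /= lee_fin [leRHS]ger0_norm ?addr_ge0 ?sqr_ge0 //.
rewrite -[l ^+ 2]real_normK ?num_real //.
have := sqr_ge0 (`|l| - 1); nra.
Qed.

(** The quadratic form <T x, x> is additive on u + v because the scalar measures
    are; hence <T u, v> + <T v, u> has zero real part, and both terms have the
    same one by symmetry. *)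
Lemma graph_orth B u v y y' : measurable B -> E B u = u -> E B v = 0 ->
  T (u, y) -> T (v, y') -> rip y v = 0.
Proof.
move=> mB uB vB Tu Tv.
have [nu hu] := scalar_measure_ex hE u.
have [nu' hv] := scalar_measure_ex hE v.
have Tuv := graphD Tu Tv.
have := graph_rip (scalar_measure_add mB uB vB hu hv) Tuv.
have iu := integrable_id hu (ex_intro _ _ Tu).
have iv := integrable_id hv (ex_intro _ _ Tv).
rewrite /Rintegral integral_measure_add // fineD; last 2 first.
- exact: integrable_fin_num.
- exact: integrable_fin_num.
rewrite -[fine _]/(Rintegral _ _ _) -(graph_rip hu Tu).
rewrite -[fine _]/(Rintegral nu' _ _) -(graph_rip hv Tv).
rewrite !ripE (graph_sym Tv Tu) (ripC _ v); lra.
Qed.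

(** T u is orthogonal to E(~` B) (dom T), which is dense in the range of
    E(~` B). *)
Lemma graph_pvm_range B x y : measurable B -> T (x, y) -> E B x = x -> E B y = y.
Proof.
move=> mB Tx xB; have mC := measurableC mB.
suff y0 : E (~` B) y = 0 by rewrite [RHS](pvmCx hE _ mB) y0 addr0.
have [_ dT _] := saT; apply: (dense_orth hip dT) => v dv.
have [y' Tv] := dom_pvm mC dv.
rewrite (pvm_rip hE) //; apply: (graph_orth mB xB _ Tx Tv).
by rewrite -(pvmI hE) // setICr (pvm0 hE).
Qed.

(** E(B) commutes with T: split x along E(B) and E(~` B), both of which stay in
    the domain, and apply graph_pvm_range to the two pieces. *)
Lemma graph_pvm B x y : measurable B -> T (x, y) -> T (E B x, E B y).
Proof.
move=> mB Tx; have mC := measurableC mB.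
have dx : dom T x by exists y.
have [y1 T1] := dom_pvm mB dx; have [y2 T2] := dom_pvm mC dx.
have T3 : T (x, y1 + y2) by rewrite {1}(pvmCx hE x mB); exact: (graphD T1 T2).
rewrite (graph_fun Tx T3) (bounded_opD _ _ (pvm_bounded hE mB)).
rewrite (graph_pvm_range mB T1) ?(pvmK hE) //.
rewrite -(graph_pvm_range mC T2) ?(pvmK hE) //.
by rewrite -(pvmI hE) // setICr (pvm0 hE) addr0.
Qed.

End SpectralResolution.

(** * Bounds on spectral subspaces *)

Section SpectralBounds.
Context {R : realType} {H : completeNormedModType R[i]}.
Variable ip : {dot H for Num.conj}.
Hypothesis hip : induces_norm ip.
Variables (T : set (H * H)) (E : set R -> H -> H).
Hypothesis saT : selfadjoint ip T.
Hypothesis posT : forall p, T p -> 0 <= ip p.2 p.1.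
Hypothesis hTE : spectral_resolution ip T E.

Local Notation rip := (real_ip ip).
Local Notation sqn := (sqnorm ip).

Let hE : projection_valued_measure ip E. Proof. by case: hTE. Qed.

Lemma scalar_measure_range B u nu : measurable B -> E B u = u ->
  scalar_measure ip E u nu -> nu B = (sqn u)%:E /\ nu (~` B) = 0%E.
Proof.
move=> mB uB /(scalar_measureP hE) h; have mC := measurableC mB.
by rewrite !h // uB -[in E (~` B) u]uB -(pvmI hE) // setICl (pvm0 hE) sqn0.
Qed.

Lemma dom_bounded B u (c : R) : measurable B -> E B u = u ->
  (forall l, B l -> l ^+ 2 <= c) -> dom T u.
Proof.
move=> mB uB hc; have mC := measurableC mB.
have [nu h] := scalar_measure_ex hE u.
have [nB nC] := scalar_measure_range mB uB h.
have msq D : measurable_fun D (EFin \o (fun l : R => l ^+ 2)).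
  by apply/measurable_EFinP; exact: measurable_funX.
apply/(dom_intgl hTE h).
rewrite (@ge0_negligible_integral _ _ _ _ _ (~` B)) //; last first.
  by move=> l _; rewrite lee_fin sqr_ge0.
rewrite setTD setCK.
apply: (@le_lt_trans _ _ (\int[nu]_(l in B) c%:E)%E).
  by apply: ge0_le_integral => // l _; rewrite lee_fin sqr_ge0.
rewrite integral_cst // nB -EFinM ltry //.
Qed.

Lemma graph_rip_range B u y nu : measurable B -> E B u = u -> T (u, y) ->
  scalar_measure ip E u nu ->
  nu.-integrable B (fun l : R => l%:E) /\ (rip y u)%:E = (\int[nu]_(l in B) l%:E)%E.
Proof.
move=> mB uB Tu h; have mC := measurableC mB.
have [nB nC] := scalar_measure_range mB uB h.
have iT := integrable_id hTE h (ex_intro _ _ Tu).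
have iB : nu.-integrable B (fun l : R => l%:E).
  exact: (integrableS _ _ _ iT).
split => //; rewrite (graph_rip hTE h Tu) /Rintegral.
rewrite (@negligible_integral _ _ _ _ _ (~` B)) // setTD setCK.
by rewrite fineK // integrable_fin_num.
Qed.

Let integrable_const B u c nu : measurable B -> scalar_measure ip E u nu ->
  nu.-integrable B (fun _ : R => c%:E).
Proof.
move=> mB /(scalar_measureP hE) h; apply/integrableP; split => //.
by rewrite integral_cst // h // -EFinM ltry.
Qed.

Lemma graph_rip_le B u y (t : R) : measurable B -> E B u = u -> T (u, y) ->
  (forall l, B l -> l <= t) -> rip y u <= t * sqn u.
Proof.
move=> mB uB Tu hl; have [nu h] := scalar_measure_ex hE u.
have [iB e] := graph_rip_range mB uB Tu h.
have [nB nC] := scalar_measure_range mB uB h.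
rewrite -lee_fin e EFinM -nB -integral_cst //.
apply: le_integral => //; last by move=> l; rewrite inE lee_fin; exact: hl.
exact: integrable_const h.
Qed.

Lemma graph_rip_ge B u y (s : R) : measurable B -> E B u = u -> T (u, y) ->
  (forall l, B l -> s <= l) -> s * sqn u <= rip y u.
Proof.
move=> mB uB Tu hl; have [nu h] := scalar_measure_ex hE u.
have [iB e] := graph_rip_range mB uB Tu h.
have [nB nC] := scalar_measure_range mB uB h.
rewrite -lee_fin e EFinM -nB -integral_cst //.
apply: le_integral => //; last by move=> l; rewrite inE lee_fin; exact: hl.
exact: integrable_const h.
Qed.

Lemma graph_rip_ge0 u y : T (u, y) -> 0 <= rip y u.
Proof. by move=> /posT /=; rewrite ipE lecE /= => /andP[]. Qed.

(** T is positive on the spectral subspace and its quadratic form is at most t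
    there.  The bound on |T u| is what positivity of the form at t u - T u gives;
    the lower bound - n on B only serves to place u and T u in the domain. *)
Lemma graph_norm_le B u y (n t : R) : measurable B -> E B u = u -> T (u, y) ->
  0 < t -> (forall l, B l -> - n <= l <= t) -> sqn y <= t ^+ 2 * sqn u.
Proof.
move=> mB uB Tu t0 hl.
have yB : E B y = y by exact: (graph_pvm_range hip saT hTE mB Tu uB).
have [z Ty] : dom T y.
  apply: (dom_bounded mB yB (c := n ^+ 2 + t ^+ 2)) => l /hl /andP[nl lt].
  by have [l0|l0] := leP 0 l; nra.
have h1 := graph_rip_le mB uB Tu (fun l Bl => (andP (hl l Bl)).2).
have h2 := graph_rip_le mB yB Ty (fun l Bl => (andP (hl l Bl)).2).
have hs := graph_sym saT Ty Tu.
have := graph_rip_ge0 (graphD saT (graphZ saT (t%:C) Tu) (graphZ saT (-1) Ty)).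
rewrite !scaleN1r !ripE -/(sqn _) hs -/(sqn _).
nra.
Qed.

(** Expand 0 <= |T u - s u|^2. *)
Lemma graph_norm_ge B u y (s : R) : measurable B -> E B u = u -> T (u, y) ->
  0 < s -> (forall l, B l -> s <= l) -> s ^+ 2 * sqn u <= sqn y.
Proof.
move=> mB uB Tu s0 hl; have h := graph_rip_ge mB uB Tu hl.
have := sqn_ge0 ip (y - s%:C *: u); rewrite sqnB sqnZ ripZr; nra.
Qed.

End SpectralBounds.

(** * Spectral projections of an affiliated operator *)

Section Affiliation.
Context {R : realType} {H : completeNormedModType R[i]}.
Variable ip : {dot H for Num.conj}.
Hypothesis hip : induces_norm ip.

Local Notation rip := (real_ip ip).
Local Notation sqn := (sqnorm ip).

Lemma adjoint_pairC S T : adjoint_pair ip S T -> adjoint_pair ip T S.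
Proof. by move=> ST x y; rewrite ipC -ST -ipC. Qed.

Section Commutant.
Variable M : set (H -> H).
Hypothesis hM : von_neumann_algebra ip M.

Lemma vN_bounded U : M U -> bounded_op U.
Proof. by case: hM => _ <- []. Qed.

Lemma commutant_adjoint S : commutant M S ->
  exists2 S', commutant M S' & adjoint_pair ip S S'.
Proof.
move=> [bS cS]; have [S' bS' SS'] := adjoint_exists hip bS.
exists S' => //; split => // U MU.
have [U' bU' UU'] := adjoint_exists hip (vN_bounded MU).
have MU' : M U' by case: hM => + _; apply; [exact: MU|].
apply/funext => y /=; apply: (@ip_rip_inj _ _ ip) => x.
rewrite -SS' -(adjoint_pairC UU') -(adjoint_pairC UU') -SS'.
by rewrite -[U' (S x)]/((U' \o S) x) -cS.
Qed.

End Commutant.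

Section Resolution.
Variables (M : set (H -> H)) (a T : set (H * H)) (E : set R -> H -> H).
Hypothesis hM : von_neumann_algebra ip M.
Hypothesis aff : affiliated M a.
Hypothesis haT : is_absolute_value ip a T.
Hypothesis hTE : spectral_resolution ip T E.

Let hE : projection_valued_measure ip E. Proof. by case: hTE. Qed.
Let saT : selfadjoint ip T. Proof. by case: haT. Qed.
Let posT : forall p, T p -> 0 <= ip p.2 p.1. Proof. by case: haT. Qed.

(** S a is contained in a S by affiliation, and S a^* in a^* S because the
    adjoint of S lies in the commutant too. *)
Lemma commutant_square S x z : commutant M S ->
  (T \; T)%relation (x, z) -> (T \; T)%relation (S x, S z).
Proof.
case: haT => _ _ -> cS [y /= axy ayz]; exists (S y); first exact: aff.
move=> [u v] auv /=; have [S' cS' SS'] := commutant_adjoint hM cS.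
rewrite -!(adjoint_pairC SS').
exact: (ayz (S' u, S' v) (aff cS' auv)).
Qed.

(** Induction on k, one step replacing x by T (T x): this vector stays in the
    range of E(B) and is at most t^2 |x|, while E(C) S intertwines T^2 with its
    restriction to the range of E(C), where it is at least s^2. *)
Lemma spectral_growth S B C (n t s K : R) : commutant M S ->
  measurable B -> measurable C -> 0 < t -> 0 < s -> 0 <= K ->
  (forall x, sqn (S x) <= K * sqn x) ->
  (forall l, B l -> - n <= l <= t) -> (forall l, C l -> s <= l) ->
  forall k x, E B x = x ->
  (s ^+ 4) ^+ k * sqn (E C (S x)) <= K * (t ^+ 4) ^+ k * sqn x.
Proof.
move=> cS mB mC t0 s0 K0 hK hB hC; elim => [|k IH] x xB.
  rewrite !expr0 mul1r mulr1; exact: (le_trans (sqn_pvm_le hE _ mC) (hK x)).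
have bnd u : E B u = u ->
    exists2 y, T (u, y) & E B y = y /\ sqn y <= t ^+ 2 * sqn u.
  move=> uB; have [|y Tu] := dom_bounded hTE (c := n ^+ 2 + t ^+ 2) mB uB.
    by move=> l /hB /andP[nl lt]; have [l0|l0] := leP 0 l; nra.
  exists y => //; split; first exact: (graph_pvm_range hip saT hTE mB Tu uB).
  exact: (graph_norm_le hip saT posT hTE mB uB Tu t0 hB).
have [y Txy [yB hy]] := bnd x xB; have [z Tyz [zB hz]] := bnd y yB.
have [] := @commutant_square S x z cS; first by exists y.
move=> w /= /(graph_pvm hip saT hTE mC) T1 /(graph_pvm hip saT hTE mC) T2.
have h1 := graph_norm_ge hTE mC (pvmK hE _ mC) T1 s0 hC.
have h2 := graph_norm_ge hTE mC (pvmK hE _ mC) T2 s0 hC.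
have h3 : s ^+ 4 * sqn (E C (S x)) <= sqn (E C (S z)).
  apply: le_trans h2; rewrite -[4%N]/(2 + 2)%N exprD -mulrA.
  by rewrite ler_wpM2l // exprn_ge0 // ltW.
have h4 : sqn z <= t ^+ 4 * sqn x.
  apply: (le_trans hz); rewrite -[4%N]/(2 + 2)%N exprD -mulrA.
  by rewrite ler_wpM2l // exprn_ge0 // ltW.
rewrite exprSr -mulrA; apply: le_trans (_ : (s ^+ 4) ^+ k * sqn (E C (S z)) <= _).
  by rewrite ler_wpM2l // exprn_ge0 // exprn_ge0 // ltW.
apply: (le_trans (IH z zB)); rewrite [_ ^+ k.+1]exprSr mulrA -[leRHS]mulrA.
by rewrite ler_wpM2l // mulr_ge0 // exprn_ge0 // exprn_ge0 // ltW.
Qed.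

(** Three limits: k to infinity in spectral_growth for a spectral gap [t, s] and
    a bounded piece ]- n, t], then n to infinity, then s down to t. *)
Lemma spectral_cut S (t : R) x : commutant M S -> 0 < t ->
  E `]t, +oo[ (S (E `]-oo, t] x)) = 0.
Proof.
move=> cS t0; have [bS _] := cS; have [K K0 hK] := bounded_op_sqn hip bS.
have sep (s : R) n u : t < s -> E `]- n%:R, t] u = u -> E `[s, +oo[ (S u) = 0.
  move=> ts uB; apply: (@sqn_eq0 _ _ ip).
  have s0 : 0 < s by exact: lt_trans ts.
  have hk k : sqn (E `[s, +oo[ (S u)) <= ((t / s) ^+ 4) ^+ k * (K * sqn u).
    have hB (l : R) : `]- n%:R, t]%classic l -> - n%:R <= l <= t.
      by rewrite /= in_itv /= => /andP[/ltW -> ->].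
    have hC (l : R) : `[s, +oo[%classic l -> s <= l by rewrite /= in_itv /= andbT.
    have := spectral_growth cS _ _ t0 s0 K0 hK hB hC k uB.
    move=> /(_ (measurable_itv _) (measurable_itv _)).
    have -> : ((t / s) ^+ 4) ^+ k * (K * sqn u)
        = K * (t ^+ 4) ^+ k * sqn u / (s ^+ 4) ^+ k.
      by rewrite expr_div_n (expr_div_n (t ^+ 4)); ring.
    by rewrite ler_pdivlMr 1?mulrC // exprn_gt0 // exprn_gt0.
  apply/eqP; rewrite eq_le sqn_ge0 andbT leNgt; apply/negP => q0.
  set q := sqn _ in hk q0.
  have r1 : `|(t / s) ^+ 4| < 1.
    rewrite ger0_norm ?exprn_ge0 ?divr_ge0 ?ltW // exprn_ilt1 //.
      by rewrite divr_ge0 // ltW.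
    by rewrite ltr_pdivrMr // mul1r.
  have c0 : 0 < K * sqn u + 1 by rewrite ltr_wpDl // mulr_ge0 // sqn_ge0.
  have /cvgrPdist_lt /(_ _ (divr_gt0 q0 c0)) [k _ /(_ k (leqnn k))] :=
    cvg_expr r1.
  rewrite /= sub0r normrN ger0_norm; last by rewrite !exprn_ge0 // divr_ge0 // ltW.
  rewrite ltr_pdivlMr // => h; have := hk k.
  have := exprn_ge0 k (exprn_ge0 4 (divr_ge0 (ltW t0) (ltW s0))); nra.
have mi (i : interval R) : measurable [set` i] := measurable_itv i.
have sep2 s : t < s -> E `[s, +oo[ (S (E `]-oo, t] x)) = 0.
  move=> ts; apply: (@sqn_eq0 _ _ ip); apply/eqP; rewrite eq_le sqn_ge0 andbT.
  apply/ler_addgt0Pr => e e0; rewrite add0r.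
  have d0 : 0 < e / (K + 1) by rewrite divr_gt0 // ltr_wpDl.
  have nd : nondecreasing_seq (fun k : nat => `]- k%:R, t]%classic : set R).
    move=> k l kl; rewrite subsetEset => y /=; rewrite !in_itv /= => /andP[h ->].
    by rewrite andbT (le_lt_trans _ h) // lerN2 ler_nat.
  have [n] := pvm_bigcup hE x (fun k => mi _) nd d0.
  rewrite -itvNybndEbigcup => hn.
  have := sep s n (E `]- n%:R, t] x) ts (pvmK hE _ (mi _)) => h0.
  have -> : E `[s, +oo[ (S (E `]-oo, t] x))
      = E `[s, +oo[ (S (E `]-oo, t] x - E `]- n%:R, t] x)).
    rewrite (bounded_opB _ _ bS) (bounded_opB _ _ (pvm_bounded hE (mi _))).
    by rewrite h0 subr0.
  apply: (le_trans (sqn_pvm_le hE _ (mi _))); apply: (le_trans (hK _)).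
  move: hn; rewrite ltr_pdivlMr ?ltr_wpDl // => hn.
  have := sqn_ge0 ip (E `]-oo, t] x - E `]- n%:R, t] x); nra.
apply: (@sqn_eq0 _ _ ip); apply/eqP; rewrite eq_le sqn_ge0 andbT.
apply/ler_addgt0Pr => e e0; rewrite add0r.
have nd : nondecreasing_seq (fun k : nat => `[t + k.+1%:R^-1, +oo[%classic : set R).
  move=> k l kl; rewrite subsetEset => y /=; rewrite !in_itv /= !andbT.
  by apply: le_trans; rewrite lerD2l lef_pV2 ?posrE // ler_nat.
have [n] := pvm_bigcup hE (S (E `]-oo, t] x)) (fun k => mi _) nd e0.
by rewrite -itvoyEbigcup sep2 ?ltrDl ?invr_gt0 // subr0 => /ltW.
Qed.

(** With Q = E(]t, oo[) and P = 1 - Q, spectral_cut gives Q S P = 0, and for the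
    adjoint of S it gives P S Q = 0 by duality; so S commutes with Q. *)
Lemma spectral_projection_mem (t : R) : 0 < t -> M (E `]t, +oo[).
Proof.
move=> t0; case: (hM) => _ <-.
have mQ : measurable (`]t, +oo[%classic : set R) by exact: measurable_itv.
have mP := measurableC mQ.
split; first exact: (pvm_bounded hE).
move=> S cS; have [S' cS' SS'] := commutant_adjoint hM cS.
have [bS _] := cS.
have cut U x : commutant M U -> E `]t, +oo[ (U (E (~` `]t, +oo[) x)) = 0.
  by move=> cU; rewrite setCitvr; exact: spectral_cut.
apply/funext => x /=; apply/esym.
rewrite [in RHS](pvmCx hE x mQ) (bounded_opD _ _ bS).
rewrite (bounded_opD _ _ (pvm_bounded hE mQ)) (cut S x cS) addr0.
rewrite [LHS](pvmCx hE _ mQ) [X in _ + X](_ : _ = 0) ?addr0 //.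
apply: (@ip_rip_inj _ _ ip) => y.
rewrite -(pvm_ip hE) // -(adjoint_pairC SS') -(pvm_ip hE) // (cut S' _ cS').
by rewrite linear0l linear0r.
Qed.

End Resolution.
End Affiliation.

(** * Finiteness of the rearrangement *)

Section Distribution.
Context {R : realType} {H : completeNormedModType R[i]}.
Variable ip : {dot H for Num.conj}.
Hypothesis hip : induces_norm ip.
Variables (M : set (H -> H)) (tr : (H -> H) -> \bar R).
Hypothesis hM : von_neumann_algebra ip M.
Hypothesis htr : nsf_trace ip M tr.

Local Notation rip := (real_ip ip).
Local Notation sqn := (sqnorm ip).

Lemma vN0 : M (fun _ => 0).
Proof.
case: hM => _ <-; split.
  apply: (sqn_bounded_op hip) => [c x y|]; first by rewrite scaler0 addr0.
  by exists 0 => // x; rewrite sqn0 mul0r.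
by move=> S [bS _]; apply/funext => x /=; rewrite (bounded_op0 bS).
Qed.

Lemma trace0 : tr (fun _ => 0) = 0%E.
Proof.
have p0 : positive_part ip M (fun _ => 0).
  by split; [exact: vN0 | move=> x; rewrite linear0l].
have := traceZ htr (lexx 0) p0; rewrite mul0e => <-; congr tr.
by apply/funext => x; rewrite /GRing.scale /= scaler0.
Qed.

Lemma pvm_ipE (E : set R -> H -> H) B x :
  projection_valued_measure ip E -> measurable B ->
  ip (E B x) x = (sqn (E B x))%:C.
Proof.
by move=> hE mB; rewrite -{1}(pvmK hE) // (pvm_ip hE) // ip_sqn.
Qed.

Lemma pvm_le_op (E : set R -> H -> H) B C :
  projection_valued_measure ip E -> measurable B -> measurable C ->
  B `<=` C -> le_op ip (E B) (E C).
Proof.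
move=> hE mB mC BC x; rewrite !pvm_ipE // lecR -subr_ge0 -(sqn_pvmB hE) //.
exact: sqn_ge0.
Qed.

Lemma pvm_positive (E : set R -> H -> H) B :
  projection_valued_measure ip E -> measurable B ->
  M (E B) -> positive_part ip M (E B).
Proof.
by move=> hE mB MB; split => // x; rewrite pvm_ipE // lecR sqn_ge0.
Qed.

Section Tail.
Variable E : set R -> H -> H.

(** E(]t, oo[) is the least upper bound of the increasing sequence of projections
    E(]t, t + n]), so some E(]t, t + n]) has trace greater than
    tr E(]t, oo[) - 1; the complement E(]t + n, oo[) then has trace less
    than 1. *)
Lemma trace_tail a T (t : R) : affiliated M a -> is_absolute_value ip a T ->
  spectral_resolution ip T E -> 0 < t -> (tr (E `]t, +oo[) < +oo)%E ->
  exists2 s, 0 <= s & (tr (E `]s, +oo[) <= 1)%E.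
Proof.
move=> aff haT hTE t0 tfin.
have hE : projection_valued_measure ip E by case: hTE.
have mi (i : interval R) : measurable [set` i] := measurable_itv i.
have Mi s : 0 < s -> M (E `]s, +oo[).
  exact: (spectral_projection_mem hip hM aff haT hTE).
pose F (n : nat) : set R := `]t, t + n%:R]%classic.
have tn n : t <= t + n%:R by rewrite lerDl.
have tn0 n : 0 < t + n%:R by rewrite (lt_le_trans t0).
have split n : E `]t, +oo[ = E (F n) + E `]t + n%:R, +oo[.
  apply/funext => x.
  rewrite -[RHS]/(E (F n) x + E `]t + n%:R, +oo[ x) -(pvmU hE) //.
  - by congr (E _ x); rewrite -itv_bndbnd_setU // bnd_simp.
  - exact: mi.
  - apply/seteqP; split => // y []; rewrite /F /= !in_itv /= andbT.
    by move=> /andP[_ /le_lt_trans h] /h; rewrite ltxx.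
have MF n : M (E (F n)).
  have := Mi t t0; have := Mi _ (tn0 n); case: (hM) => _ <- [_ c2] [_ c1].
  split; first exact: (pvm_bounded hE (mi _)).
  move=> S cS; have [bS _] := cS; apply/funext => x /=.
  have eF y : E (F n) y = E `]t, +oo[ y - E `]t + n%:R, +oo[ y.
    by rewrite (congr1 (fun f => f y) (split n)) addrK.
  have h1 : E `]t, +oo[ (S x) = S (E `]t, +oo[ x).
    by have := congr1 (fun f => f x) (c1 S cS).
  have h2 : E `]t + n%:R, +oo[ (S x) = S (E `]t + n%:R, +oo[ x).
    by have := congr1 (fun f => f x) (c2 S cS).
  by rewrite !eF (bounded_opB _ _ bS) h1 h2.
have pF n := pvm_positive hE (mi _) (MF n).
have pQ s (s0 : 0 < s) := pvm_positive hE (mi _) (Mi s s0).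
have ndF : nondecreasing_seq F.
  move=> n m nm; rewrite subsetEset => y; rewrite /F /= !in_itv /= => /andP[-> h] /=.
  by rewrite (le_trans h) // lerD2l ler_nat.
have FQ n : F n `<=` `]t, +oo[ by move=> y; rewrite /F /= !in_itv /= => /andP[->].
have Fcup : `]t, +oo[%classic = \bigcup_n F n by rewrite itv_bndy_bigcup_BRight.
have tsup : tr (E `]t, +oo[) = ereal_sup (tr @` range (fun n => E (F n))).
  apply: (trace_normal htr).
  - by move=> _ [n _ <-]; exact: pF.
  - split; first by exists (E (F 0%N)), 0%N.
    move=> _ _ [n _ <-] [m _ <-]; exists (E (F (maxn n m))); split.
    + by exists (maxn n m).
    + apply: (pvm_le_op hE (mi _) (mi _)).
      by rewrite -subsetEset; apply: ndF; exact: leq_maxl.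
    + apply: (pvm_le_op hE (mi _) (mi _)).
      by rewrite -subsetEset; apply: ndF; exact: leq_maxr.
  - split; first exact: pQ.
      move=> _ [n _ <-]; exact: (pvm_le_op hE (mi _) (mi _) (FQ n)).
    move=> U [MU posU] hU x; have := posU x.
    have hn n : ip (E (F n) x) x <= ip (U x) x by apply: hU; exists n.
    case: (ip (U x) x) hn => r i hn; rewrite lecE /= => /andP[/eqP i0 r0].
    rewrite pvm_ipE // lecE /= i0 eqxx /=; apply/ler_addgt0Pr => e e0.
    have [n] := pvm_bigcup hE x (fun n => mi _ : measurable (F n)) ndF e0.
    rewrite -Fcup (sqn_pvmB hE x (mi _) (mi _) (@FQ n)).
    by have := hn n; rewrite (pvm_ipE x hE (mi _)) lecE /= => /andP[_]; lra.
have tr0 := trace_ge0 htr (pQ _ t0).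
have qfin : tr (E `]t, +oo[) \is a fin_num by rewrite ge0_fin_numE.
have : (tr (E `]t, +oo[) - 1 < ereal_sup (tr @` range (fun n => E (F n))))%E.
  by rewrite -tsup lteBlDr // lteDl.
move=> /ereal_sup_gt[_ [_ [n _ <-] <-]] hn.
exists (t + n%:R); first exact: ltW.
have trD : (tr (E `]t, +oo[) = tr (E (F n)) + tr (E `](t + n%:R)%R, +oo[))%E.
  by rewrite {1}(split n) (traceD htr (pF n) (pQ _ (tn0 n))).
have f0 := trace_ge0 htr (pF n); have g0 := trace_ge0 htr (pQ _ (tn0 n)).
move: f0 g0 qfin hn; rewrite trD.
case: (tr (E (F n))) => [r| |] //; case: (tr _) => [r'| |] //.
by rewrite !lee_fin -EFinD -EFinB lte_fin => *; lra.
Qed.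

End Tail.

End Distribution.

(** * Doubling ratios *)

Section Doubling.
Context {R : realType}.
Implicit Types (m S : R -> R) (t eps d N : R).

Lemma geometric_small (C r e : R) : 0 <= r < 1 -> 0 < e ->
  exists n, forall k, (n <= k)%N -> C * r ^+ k < e.
Proof.
move=> /andP[r0 r1] e0.
have c0 : 0 < `|C| + 1 by rewrite ltr_wpDl.
have rn : `|r| < 1 by rewrite ger0_norm.
have /cvgrPdist_lt /(_ _ (divr_gt0 e0 c0)) [n _ hn] := cvg_expr rn.
exists n => k /hn; rewrite sub0r normrN ger0_norm ?exprn_ge0 // ltr_pdivlMr // => h.
apply: le_lt_trans h; rewrite mulrC ler_wpM2l ?exprn_ge0 //.
by rewrite (le_trans (ler_norm C)) // lerDl.
Qed.

Lemma powR2_ln (q : R) : 0 < q -> 2 `^ (ln q / ln 2) = q.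
Proof.
move=> q0; have l2 : 0 < ln (2 : R) by rewrite ln_gt0 // ltr1n.
by rewrite /powR pnatr_eq0 /= mulfVK ?gt_eqF // lnK // posrE.
Qed.

Lemma powR_dyadic N eps k : 0 <= N ->
  (N * 2 ^+ k) `^ eps = N `^ eps * (2 `^ eps) ^+ k.
Proof.
move=> N0; rewrite powRM // ?exprn_ge0 // -[2 ^+ k](powR_mulrn k (ler0n R 2)).
rewrite -[(2 `^ eps) ^+ k](powR_mulrn k (powR_ge0 2 eps)).
by rewrite -!powRrM [_ * eps]mulrC.
Qed.

Lemma dyadic_between N t : 0 < N -> N <= t ->
  exists k, N * 2 ^+ k <= t < N * 2 ^+ k.+1.
Proof.
move=> N0 Nt.
have [n hn] : exists n, t < N * 2 ^+ n.
  have t0 : 0 < t by exact: lt_le_trans Nt.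
  have [|n hn] := @geometric_small t (2^-1) N _ N0.
    by rewrite invr_ge0 ler0n invf_lt1 ?ltr1n.
  exists n; have := hn n (leqnn n).
  by rewrite exprVn ltr_pdivrMr // exprn_gt0.
have ex : exists n, t < N * 2 ^+ n by exists n.
case: (ex_minnP ex) => -[|k] hk mink.
  by move: hk; rewrite expr0 mulr1 ltNge Nt.
exists k; rewrite hk andbT leNgt; apply/negP => /mink; by rewrite ltnn.
Qed.

(** Otherwise S (2 t) >= (1 + d) S t for all large t.  At t = 2^k P this gives
    d (1 + d)^k S P <= d S t <= t m(t) <= t^eps, which is a constant times
    (1 + d / 2)^k for the exponent eps with 2^eps = 1 + d / 2. *)
Lemma doubling_increasing m S N0 d N : 0 < d ->
  (forall eps, 0 < eps -> exists N', forall t, N' <= t -> t * m t <= t `^ eps) ->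
  (forall t, N0 <= t ->
     0 < S t /\ S t <= S (2 * t) /\ S (2 * t) <= S t + t * m t) ->
  exists2 t, N <= t & S (2 * t) < (1 + d) * S t.
Proof.
move=> d0 hm hS; apply: contrapT => hcon.
have hN t : N <= t -> (1 + d) * S t <= S (2 * t).
  by move=> Nt; rewrite leNgt; apply/negP => lt; apply: hcon; exists t.
(* any q strictly between 1 and 1 + d would do *)
pose q := 1 + d / 2; have q0 : 0 < q by rewrite addr_gt0 // divr_gt0.
have l2 : 0 < ln (2 : R) by rewrite ln_gt0 // ltr1n.
have eps0 : 0 < ln q / ln 2 by rewrite divr_gt0 // ln_gt0 // ltrDl divr_gt0.
have [N' hN'] := hm _ eps0; set eps := ln q / ln 2 in eps0 hN'.
have eqq : 2 `^ eps = q := powR2_ln q0.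
pose P := Num.max (Num.max N N') (Num.max N0 1).
have P0 : 0 < P by rewrite !lt_max ltr01 !orbT.
have Pk k : P <= P * 2 ^+ k by rewrite ler_pMr // exprn_ege1 // ler1n.
have step k : 2 * (P * 2 ^+ k) = P * 2 ^+ k.+1 by rewrite exprS mulrCA.
have NP k : N <= P * 2 ^+ k by rewrite (le_trans _ (Pk k)) // !le_max lexx.
have N'P k : N' <= P * 2 ^+ k by rewrite (le_trans _ (Pk k)) // !le_max lexx orbT.
have N0P k : N0 <= P * 2 ^+ k by rewrite (le_trans _ (Pk k)) // !le_max lexx !orbT.
have S0 : 0 < S P by have := N0P 0; rewrite expr0 mulr1 => /hS[].
have grow k : (1 + d) ^+ k * S P <= S (P * 2 ^+ k).
  elim: k => [|k IH]; first by rewrite !expr0 mul1r mulr1.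
  rewrite -step; apply: le_trans (hN _ (NP k)); rewrite exprS -mulrA.
  by rewrite ler_wpM2l // addr_ge0 // ltW.
have bnd k : d * S P * (1 + d) ^+ k <= P `^ eps * q ^+ k.
  have [_ [_ h1]] := hS _ (N0P k); have h2 := hN _ (NP k); have h3 := hN' _ (N'P k).
  rewrite (powR_dyadic eps k (ltW P0)) eqq in h3; have h4 := grow k.
  have := ler_wpM2l (ltW d0) h4.
  rewrite (_ : d * (_ * _) = d * S P * (1 + d) ^+ k); last by ring.
  move=> h5; apply: (le_trans h5); lra.
have r01 : 0 <= q / (1 + d) < 1.
  have d1 : 0 < 1 + d by rewrite addr_gt0.
  by rewrite divr_ge0 ?ltW //= ltr_pdivrMr // mul1r /q; lra.
have [n /(_ n (leqnn n))] :=
  geometric_small (P `^ eps) r01 (mulr_gt0 d0 S0).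
rewrite expr_div_n mulrA ltr_pdivrMr ?exprn_gt0 ?addr_gt0 // => lt.
by have := lt_le_trans lt (bnd n); rewrite ltxx.
Qed.

(** Otherwise S (2 t) <= (1 - d) S t for all large t, so that S (2^k P) decays
    like (1 - d)^k, and t m(t) <= C (1 - d)^k for t between two consecutive
    2^k P.  Such t satisfy t^eps <= C' (1 + d)^k for the exponent eps with
    2^eps = 1 + d, and (1 - d) (1 + d) < 1, so t m(t) t^eps tends to 0. *)
Lemma doubling_decreasing m S N0 d N : 0 < d ->
  {in `[1, +oo[ &, {homo m : x y /~ x <= y}} ->
  (forall eps N', 0 < eps -> exists2 t, N' <= t & 1 <= t * m t * t `^ eps) ->
  (forall t, N0 <= t -> 0 < S t /\ S (2 * t) <= S t /\ t * m (2 * t) <= S t) ->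
  exists2 t, N <= t & (1 - d) * S t < S (2 * t).
Proof.
move=> d0 mm hm hS; apply: contrapT => hcon.
have hN t : N <= t -> S (2 * t) <= (1 - d) * S t.
  by move=> Nt; rewrite leNgt; apply/negP => lt; apply: hcon; exists t.
pose P := Num.max N (Num.max N0 1).
have P0 : 0 < P by rewrite !lt_max ltr01 !orbT.
have P1 : 1 <= P by rewrite !le_max lexx !orbT.
have Pk k : P <= P * 2 ^+ k by rewrite ler_pMr // exprn_ege1 // ler1n.
have step k : 2 * (P * 2 ^+ k) = P * 2 ^+ k.+1 by rewrite exprS mulrCA.
have NP k : N <= P * 2 ^+ k by rewrite (le_trans _ (Pk k)) // !le_max lexx.
have N0P k : N0 <= P * 2 ^+ k by rewrite (le_trans _ (Pk k)) // !le_max lexx !orbT.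
have S0 : 0 < S P by have := N0P 0; rewrite expr0 mulr1 => /hS[].
have d1 : 0 < 1 - d.
  have := hN _ (NP 0); have [] := hS _ (N0P 1%N); rewrite -step => h _ h'.
  have := lt_le_trans h h'; rewrite pmulr_lgt0 //.
  by have [] := hS _ (N0P 0).
have decay k : S (P * 2 ^+ k) <= (1 - d) ^+ k * S P.
  elim: k => [|k IH]; first by rewrite !expr0 mul1r mulr1.
  rewrite -step; apply: (le_trans (hN _ (NP k))); rewrite exprS -mulrA.
  by rewrite ler_wpM2l // ltW.
pose q := 1 + d; have q0 : 0 < q by rewrite addr_gt0.
have l2 : 0 < ln (2 : R) by rewrite ln_gt0 // ltr1n.
have eps0 : 0 < ln q / ln 2 by rewrite divr_gt0 // ln_gt0 // ltrDl.
set eps := ln q / ln 2 in eps0.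
have eqq : 2 `^ eps = q := powR2_ln q0.
pose C := 4 * S P * (P * 4) `^ eps.
have bnd k t : P * 2 ^+ k.+1 <= t <= P * 2 ^+ k.+2 ->
    t * m t * t `^ eps <= C * ((1 - d) * q) ^+ k.
  move=> /andP[t1 t2].
  have t0 : 0 < t by rewrite (lt_le_trans P0) // (le_trans (Pk k.+1)).
  have le1 : m t <= m (P * 2 ^+ k.+1).
    apply: mm; rewrite ?in_itv /= ?andbT //.
      by rewrite (le_trans P1) // (le_trans (Pk k.+1)).
    by rewrite (le_trans P1).
  have [_ [_ h]] := hS _ (N0P k); rewrite step in h.
  have Pk0 : 0 < P * 2 ^+ k by rewrite mulr_gt0 // exprn_gt0.
  have tm : t * m t <= 4 * S P * (1 - d) ^+ k.
    have h6 := le_trans h (decay k).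
    have mle : P * 2 ^+ k * m t <= (1 - d) ^+ k * S P.
      by apply: le_trans h6; rewrite ler_wpM2l // ltW.
    have [m0|m0] := leP (m t) 0.
      apply: (@le_trans _ _ 0); first by rewrite mulr_ge0_le0 // ltW.
      by rewrite !mulr_ge0 ?exprn_ge0 // ltW.
    have : t * m t <= 4 * (P * 2 ^+ k) * m t.
      rewrite ler_wpM2r ?(ltW m0) // (le_trans t2) // !exprS; lra.
    lra.
  have te : t `^ eps <= (P * 4) `^ eps * q ^+ k.
    have -> : (P * 4) `^ eps * q ^+ k = (P * 2 ^+ k.+2) `^ eps.
      rewrite -eqq -powR_dyadic ?mulr_ge0 ?ltW //.
      by congr (_ `^ _); rewrite !exprS; ring.
    apply: ge0_ler_powR; rewrite ?nnegrE ?(ltW eps0) ?(ltW t0) // ltW //.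
    exact: lt_le_trans t0 t2.
  have -> : C * ((1 - d) * q) ^+ k
      = 4 * S P * (1 - d) ^+ k * ((P * 4) `^ eps * q ^+ k).
    by rewrite exprMn /C; ring.
  have C0 : 0 <= 4 * S P * (1 - d) ^+ k by rewrite !mulr_ge0 ?exprn_ge0 // ltW.
  apply: (le_trans (ler_wpM2r (powR_ge0 _ _) tm)).
  by rewrite ler_wpM2l.
have r01 : 0 <= (1 - d) * q < 1.
  by rewrite mulr_ge0 ?ltW //= /q; nra.
have [n hn] := @geometric_small C _ 1 r01 ltr01.
have [t ht h1] := hm eps (P * 2 ^+ n.+1) eps0.
have [|k /andP[k1 k2]] := @dyadic_between (P * 2 ^+ n.+1) t _ ht.
  by rewrite mulr_gt0 // exprn_gt0.
have hb : t * m t * t `^ eps <= C * ((1 - d) * q) ^+ (n + k).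
  have e j : P * 2 ^+ (n + j).+1 = P * 2 ^+ n.+1 * 2 ^+ j.
    by rewrite -mulrA -exprD addSn.
  have := e k.+1; rewrite addnS => e'.
  by apply: bnd; rewrite e e' k1 ltW.
have := le_lt_trans (le_trans h1 hb) (hn _ (leq_addr k n)).
by rewrite ltxx.
Qed.


End Doubling.

(** * Non-increasing functions of order 1 at infinity *)

Section Eccentricity.
Context {R : realType}.
Variable f : R -> \bar R.
Hypothesis f_ge0 : forall t, (0 <= f t)%E.
Hypothesis f_noninc : forall s t, s <= t -> (f t <= f s)%E.
Hypothesis f1_fin : (f 1 < +oo)%E.
Hypothesis f_ord :
  limf_einf (fun t : R => lne (f t) / (ln (1 / t))%:E)%E (pinfty_nbhs R) = 1%E.

Let m t : R := fine (f t).

Lemma fineK_ge1 t : 1 <= t -> f t = (m t)%:E.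
Proof.
by move=> t1; rewrite fineK // ge0_fin_numE // (le_lt_trans (f_noninc t1)).
Qed.

Let m_ge0 t : 0 <= m t.
Proof. exact: fine_ge0. Qed.

Let m_noninc s t : 1 <= s -> s <= t -> m t <= m s.
Proof.
move=> s1 st; rewrite -lee_fin -!fineK_ge1 ?f_noninc //; exact: le_trans st.
Qed.

Lemma log_ratio t : 1 < t -> 0 < m t ->
  (lne (f t) / (ln (1 / t))%:E)%E = (- ln (m t) / ln t)%:E.
Proof.
move=> t1 m0; have l0 : 0 < ln t by rewrite ln_gt0.
rewrite fineK_ge1 ?ltW // lne_EFin // div1r lnV ?posrE ?(lt_trans ltr01) //.
by rewrite inver oppr_eq0 gt_eqF // -EFinM invrN mulrN mulNr.
Qed.

Lemma log_ratio0 t : 1 < t -> m t = 0 ->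
  (lne (f t) / (ln (1 / t))%:E)%E = +oo%E.
Proof.
move=> t1 m0; have l0 : 0 < ln t by rewrite ln_gt0.
rewrite fineK_ge1 ?ltW // m0 le0_lneNy // div1r lnV ?posrE ?(lt_trans ltr01) //.
by rewrite inver oppr_eq0 gt_eqF // lt0_mulNye // lte_fin invrN oppr_lt0 invr_gt0.
Qed.

(** The liminf is not less than 1: eventually - ln (m t) / ln t > 1 - eps. *)
Lemma ord_upper eps : 0 < eps ->
  exists N, forall t, N <= t -> t * m t <= t `^ eps.
Proof.
move=> e0.
have : ((1 - eps)%:E < limf_einf
    (fun t : R => lne (f t) / (ln (1 / t))%:E) (pinfty_nbhs R))%E.
  by rewrite f_ord lte_fin ltrBlDr ltrDl.
rewrite limf_einfE => /ereal_sup_gt[_ [V [N [Nr hN]] <-]] h.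
exists (Num.max (N + 1) 2) => t; rewrite ge_max => /andP[tN t2].
have t1 : 1 < t by rewrite (lt_le_trans _ t2) // ltr1n.
have t0 : 0 < t by exact: lt_trans t1.
have Vt : V t by apply: hN; rewrite (lt_le_trans _ tN) // ltrDl.
have [m0|m0] := eqVneq (m t) 0; first by rewrite m0 mulr0 powR_ge0.
have mp : 0 < m t by rewrite lt_def m0 m_ge0.
have := lt_le_trans h (ereal_inf_lbound (ex_intro2 _ _ t Vt erefl)).
rewrite log_ratio // lte_fin ltr_pdivlMr ?ln_gt0 // => h1.
rewrite -ler_ln ?posrE ?mulr_gt0 ?powR_gt0 // lnM ?posrE // ln_powR; lra.
Qed.

(** The liminf is not greater than 1: arbitrarily far, - ln (m t) / ln t does not
    exceed 1 + eps. *)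
Lemma ord_lower eps N : 0 < eps ->
  exists2 t, N <= t & 1 <= t * m t * t `^ eps.
Proof.
move=> e0; apply: contrapT => hcon.
have hN t : N <= t -> t * m t * t `^ eps < 1.
  by move=> Nt; rewrite ltNge; apply/negP => h; apply: hcon; exists t.
suff : ((1 + eps)%:E <= 1%:E :> \bar R)%E by rewrite lee_fin gerDl leNgt e0.
rewrite -f_ord limf_einfE.
pose V := [set t : R | Num.max N 1 < t].
apply: (@le_trans _ _
  (ereal_inf [set (lne (f t) / (ln (1 / t))%:E)%E | t in V])); last first.
  apply: ereal_sup_ubound; exists V => //; exists (Num.max N 1).
  by split; rewrite ?num_real.
apply: le_ereal_inf_tmp => _ [t + <-]; rewrite /V /= gt_max => /andP[/ltW tN t1].
have t0 : 0 < t by exact: lt_trans t1.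
have [m0|m0] := eqVneq (m t) 0; first by rewrite log_ratio0 // leey.
have mp : 0 < m t by rewrite lt_def m0 m_ge0.
rewrite log_ratio // lee_fin ler_pdivlMr ?ln_gt0 //.
have := hN t tN; rewrite -ltr_ln ?posrE ?mulr_gt0 ?powR_gt0 //.
rewrite !lnM ?posrE ?mulr_gt0 ?powR_gt0 // ln_powR ln1; lra.
Qed.

(** A zero of f would persist by monotonicity and contradict ord_lower. *)
Lemma finite_part_gt0 t : 1 <= t -> 0 < m t.
Proof.
move=> t1; have [s ts] := @ord_lower 1 t ltr01.
rewrite lt_def m_ge0 andbT => h; apply/eqP => m0.
have : m s <= 0 by rewrite -m0 m_noninc.
have ms := m_ge0 s => ms0.
have {ms ms0} m0s : m s = 0 by apply/eqP; rewrite eq_le ms0 ms.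
by move: h; rewrite m0s mulr0 mul0r ler10.
Qed.

(** f may be infinite before 1, so the real monotone function used here is the
    finite part of f frozen at its value at 1 on the left of 1. *)
Lemma measurable_ge1 (D : set R) : measurable D -> D `<=` `[1, +oo[ ->
  measurable_fun D f.
Proof.
move=> mD D1.
apply: (@eq_measurable_fun _ _ _ _ _ (EFin \o (fun t => m (Num.max 1 t)))).
  move=> t /set_mem /D1 /=; rewrite in_itv /= andbT => t1.
  by rewrite fineK_ge1 //; move/max_idPr: t1 => ->.
apply/measurable_EFinP; apply: nonincreasing_measurable => // s t st.
by apply: m_noninc; rewrite ?ge_max !le_max lexx // st orbT.
Qed.

Local Notation mu := (@lebesgue_measure R).

(** S_infty with f in place of the rearrangement of an operator. *)
Definition S_infty_of (t : R) : \bar R :=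
  if pselect (mu.-integrable `]1, +oo[ f) then
    (\int[mu]_(s in `[t, +oo[) f s)%E
  else (\int[mu]_(s in `[1%R, t]) f s)%E.

Let mi (i : interval R) : measurable [set` i] := measurable_itv i.

Lemma int_const (c a b : R) (x y : bool) : a <= b ->
  (\int[mu]_(s in [set` Interval (BSide x a) (BSide y b)]) c%:E)%E
    = (c * (b - a))%:E.
Proof.
move=> ab; rewrite integral_cst //= lebesgue_measure_itv /= lte_fin.
case: ltP => [_|ba]; first by rewrite -EFinB -EFinM.
by rewrite (le_anti (introT andP (conj ab ba))) subrr mulr0 mule0.
Qed.

Lemma int_upper (a b : R) (x y : bool) : 1 <= a -> a <= b ->
  (\int[mu]_(s in [set` Interval (BSide x a) (BSide y b)]) f s
    <= (m a * (b - a))%:E)%E.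
Proof.
move=> a1 ab; rewrite -(int_const _ x y ab).
have sub s : [set` Interval (BSide x a) (BSide y b)] s -> a <= s.
  by rewrite /= itv_boundlr => /andP[/lteifW].
apply: ge0_le_integral => //.
- apply: measurable_ge1 => // s /sub as_.
  by rewrite /= in_itv /= andbT (le_trans a1).
- by move=> s /sub as_; rewrite -fineK_ge1 // f_noninc.
Qed.

Lemma int_lower (a b : R) (x y : bool) : 1 <= a -> a <= b ->
  ((m b * (b - a))%:E
    <= \int[mu]_(s in [set` Interval (BSide x a) (BSide y b)]) f s)%E.
Proof.
move=> a1 ab; rewrite -(int_const _ x y ab).
have sub s : [set` Interval (BSide x a) (BSide y b)] s -> a <= s.
  by rewrite /= itv_boundlr => /andP[/lteifW].
have sub2 s : [set` Interval (BSide x a) (BSide y b)] s -> s <= b.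
  by rewrite /= itv_boundlr => /andP[_ /lteifW].
apply: ge0_le_integral => //.
- by move=> s _; rewrite lee_fin.
- apply: measurable_ge1 => // s /sub as_.
  by rewrite /= in_itv /= andbT (le_trans a1).
- by move=> s /sub2 sb; rewrite -fineK_ge1 ?f_noninc // (le_trans a1).
Qed.

(** Both cases of S_infty_of satisfy the hypotheses of the matching doubling
    lemma from t = 2 on, by int_upper and int_lower on an interval between t and
    2 t. *)
Lemma S_infty_of_ratio : exists S : R -> R,
  (forall t, 2 <= t -> S_infty_of t = (S t)%:E /\ 0 < S t) /\
  forall d N, 0 < d -> exists2 t, N <= t & `|S (2 * t) / S t - 1| < d.
Proof.
have le2 (t : R) : 2 <= t -> [/\ 1 <= t, 0 < t & t <= 2 * t] by move=> t2; split; lra.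
have mge1 (t : R) : 2 <= t -> measurable_fun `[t, +oo[ f.
  move=> t2; apply: measurable_ge1 => // s /=; rewrite !in_itv /= !andbT; lra.
have [fint|nint] := pselect (mu.-integrable `]1, +oo[ f).
- pose I t := (\int[mu]_(s in `[t, +oo[) f s)%E.
  have eT t : S_infty_of t = I t.
    by rewrite /S_infty_of; case: pselect.
  exists (fun t => fine (I t)).
  have /integrableP[_ fi] := fint.
  have tail_lt (t : R) : 2 <= t -> (I t < +oo)%E.
    move=> t2; apply: le_lt_trans fi.
    under [leRHS]eq_integral do rewrite gee0_abs //.
    apply: ge0_subset_integral => //.
      by apply: measurable_ge1 => // s; rewrite /= !in_itv /= !andbT => /ltW.
    by move=> s; rewrite /= !in_itv /= !andbT; lra.
  have tail_fin (t : R) : 2 <= t -> I t \is a fin_num.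
    by move=> t2; rewrite ge0_fin_numE ?integral_ge0 // tail_lt.
  have tail_ge (t : R) : 2 <= t -> ((t * m (2 * t))%:E <= I t)%E.
    move=> t2; have [t1 t0 tt] := le2 t t2.
    rewrite (_ : t * _ = m (2 * t) * (2 * t - t)); last by ring.
    apply: (le_trans (int_lower true false t1 tt)).
    apply: ge0_subset_integral => //; first exact: mge1.
    by move=> s; rewrite /= !in_itv /= => /andP[->].
  have tail_dec (t : R) : 2 <= t -> (I (2 * t)%R <= I t)%E.
    move=> t2; apply: ge0_subset_integral => //; first exact: mge1.
    by move=> s; rewrite /= !in_itv /= !andbT; lra.
  have pos (t : R) : 2 <= t -> 0 < fine (I t).
    move=> t2; have [t1 t0 tt] := le2 t t2.
    rewrite -lte_fin fineK ?tail_fin // (lt_le_trans _ (tail_ge t t2)) // lte_fin.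
    by rewrite mulr_gt0 // finite_part_gt0 //; lra.
  have dec (t : R) : 2 <= t -> fine (I (2 * t)) <= fine (I t).
    move=> t2; apply: fine_le; last exact: tail_dec.
      by apply: tail_fin; lra.
    exact: tail_fin.
  split; first by move=> t t2; rewrite eT fineK ?tail_fin //; split=> //; exact: pos.
  move=> d N d0; pose N' := Num.max N 2.
  have [|||t] := @doubling_decreasing R m (fine \o I) 2 d N' d0.
  + move=> s t; rewrite !in_itv /= !andbT => s1 t1 st; exact: m_noninc.
  + by move=> eps N1 e0; exact: ord_lower.
  + move=> t t2; split; first exact: pos.
    split; first exact: dec.
    by rewrite -lee_fin fineK ?tail_fin // tail_ge.
  rewrite ge_max => /andP[tN t2] h; exists t => //.
  have p := pos t t2; have AB := dec t t2.
  set A := fine (I t) in h p AB *; set B := fine (I (2 * t)) in h AB *.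
  have : B / A <= 1 by rewrite ler_pdivrMr // mul1r.
  have : 1 - d < B / A by rewrite ltr_pdivlMr.
  by move=> h1 h2; rewrite ltr_norml; apply/andP; split; lra.
- pose I t := (\int[mu]_(s in `[1%R, t]) f s)%E.
  have eT t : S_infty_of t = I t.
    by rewrite /S_infty_of; case: pselect.
  exists (fun t => fine (I t)).
  have head_fin (t : R) : 2 <= t -> I t \is a fin_num.
    move=> t2; have [t1 t0 tt] := le2 t t2.
    rewrite ge0_fin_numE ?integral_ge0 //.
    by rewrite (le_lt_trans (int_upper true false _ t1)) // ltry.
  have mge (t : R) : measurable_fun `[1%R, t] f.
    by apply: measurable_ge1 => // s; rewrite /= !in_itv /= => /andP[->].
  have pos (t : R) : 2 <= t -> 0 < fine (I t).
    move=> t2; have [t1 t0 tt] := le2 t t2.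
    rewrite -lte_fin fineK ?head_fin //.
    rewrite (lt_le_trans _ (int_lower true false _ t1)) //.
    by rewrite lte_fin mulr_gt0 ?finite_part_gt0 //; lra.
  have inc (t : R) : 2 <= t -> fine (I t) <= fine (I (2 * t)).
    move=> t2; have [t1 t0 tt] := le2 t t2.
    apply: fine_le; [exact: head_fin | apply: head_fin; lra |].
    apply: ge0_subset_integral => //; first exact: mge.
    move=> s; rewrite /= !in_itv /= => /andP[-> h] /=; exact: le_trans h tt.
  split; first by move=> t t2; rewrite eT fineK ?head_fin //; split=> //; exact: pos.
  move=> d N d0; pose N' := Num.max N 2.
  have [||t] := @doubling_increasing R m (fine \o I) 2 d N' d0.
  + by move=> eps e0; exact: ord_upper.
  + move=> t t2; have [t1 t0 tt] := le2 t t2.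
    split; first exact: pos.
    split; first exact: inc.
    rewrite -lee_fin EFinD !fineK ?head_fin //; last by lra.
    have cutE : `[1, 2 * t]%classic = `[1, t]%classic `|` `]t, 2 * t]%classic.
      by apply: itv_bndbnd_setU; rewrite bnd_simp.
    rewrite /I cutE ge0_integral_setU //; last 2 first.
    * by rewrite -cutE; exact: mge.
    * rewrite disj_set2E; apply/eqP/seteqP; split => // s [] /=.
      rewrite !in_itv /= => /andP[_ h1] /andP[h2 _].
      by move: (le_lt_trans h1 h2); rewrite ltxx.
    rewrite leeD2l // (le_trans (int_upper false false t1 tt)) // lee_fin; lra.
  rewrite ge_max => /andP[tN t2] h; exists t => //.
  have AB := inc t t2; have p := pos t t2.
  set A := fine (I (2 * t)) in h AB *; set B := fine (I t) in h p AB *.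
  have : 1 <= A / B by rewrite ler_pdivlMr // mul1r.
  have : A / B < 1 + d by rewrite ltr_pdivrMr.
  by move=> h1 h2; rewrite ltr_norml; apply/andP; split; lra.
Qed.

Lemma S_infty_of_eccentric : exists2 t : nat -> R, t @ \oo --> +oo &
  (fun j => S_infty_of (2 * t j) / S_infty_of (t j))%E @ \oo --> 1%E.
Proof.
have [S [hS hr]] := S_infty_of_ratio.
have /choice[t ht] : forall n, exists t,
    [/\ n%:R <= t, 2 <= t & `|S (2 * t) / S t - 1| < n.+1%:R^-1].
  move=> n; have n0 : 0 < n.+1%:R^-1 :> R by rewrite invr_gt0.
  have [t] := hr _ (Num.max n%:R 2) n0; rewrite ge_max => /andP[t1 t2] h.
  by exists t.
exists t.
  apply/cvgryPge => A; have [n _ hn] := nbhs_infty_ger A.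
  exists n => // k /hn /= h; have [h1 _ _] := ht k; exact: le_trans h1.
have -> : (fun j => S_infty_of (2 * t j) / S_infty_of (t j))%E
    = EFin \o (fun j => S (2 * t j) / S (t j)).
  apply/funext => j /=; have [_ t2 _] := ht j.
  have [-> _] := hS _ t2; have [|-> _] := hS (2 * t j); first by lra.
  by rewrite inver gt_eqF; [rewrite -EFinM | have [] := hS _ t2].
apply: cvg_EFin; first by near=> j.
apply/cvgrPdist_lt => e e0; have [n _ hn] := near_infty_natSinv_lt (PosNum e0).
exists n => // k /hn /= h; have [_ _ hk] := ht k.
by rewrite distrC (lt_trans hk).
Unshelve. all: by end_near. Qed.

End Eccentricity.

(** * The rearrangement *)

Section Rearrangement.
Context {R : realType} {H : completeNormedModType R[i]}.
Variable ip : {dot H for Num.conj}.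
Hypothesis hip : induces_norm ip.
Variables (M : set (H -> H)) (tr : (H -> H) -> \bar R).
Hypothesis hM : von_neumann_algebra ip M.
Hypothesis htr : nsf_trace ip M tr.
Variable a : set (H * H).

Lemma rearrangement_ge0 t : (0 <= rearrangement ip tr a t)%E.
Proof. by apply: le_ereal_inf_tmp => _ [s [s0 _] <-]; rewrite lee_fin. Qed.

Lemma rearrangement_noninc s t : s <= t ->
  (rearrangement ip tr a t <= rearrangement ip tr a s)%E.
Proof.
move=> st; apply: ereal_inf_le_tmp => _ [r [r0 hr] <-]; exists r => //; split => //.
by rewrite (le_trans hr) // lee_fin.
Qed.

(** Without any spectral resolution the spectral measure takes its default value
    0 and the distribution function vanishes. *)
Lemma distribution_le1 : trace_measurable ip tr M a ->
  exists2 s, 0 <= s & (distribution_function ip tr a s <= 1)%E.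
Proof.
move=> [_ _ _ aff [t t0]]; rewrite /distribution_function /abs_spectral_measure.
case: xgetP => [E _ [T [haT hTE]] tfin|_ _].
  exact: (trace_tail hip hM htr aff haT hTE t0 tfin).
by exists 0 => //; rewrite (trace0 hip hM htr).
Qed.

Lemma rearrangement1_fin : trace_measurable ip tr M a ->
  (rearrangement ip tr a 1 < +oo)%E.
Proof.
move=> /distribution_le1[s s0 hs]; apply: (@le_lt_trans _ _ s%:E); last exact: ltry.
by apply: ereal_inf_lbound; exists s.
Qed.

End Rearrangement.

Theorem theorem1p10 (R : realType) (H : completeNormedModType R[i])
    (ip : {dot H for Num.conj}) (hip : induces_norm ip)
    (M : set (H -> H)) (hM : von_neumann_algebra ip M)
    (tr : (H -> H) -> \bar R) (htr : nsf_trace ip M tr)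
    (a : set (H * H)) (ha : trace_measurable ip tr M a)
    (hord : ord_infty ip tr a = 1%E) :
  infty_eccentric ip tr a.
Proof.
exact: (S_infty_of_eccentric (rearrangement_ge0 ip tr a)
  (@rearrangement_noninc _ _ ip tr a) (rearrangement1_fin hip hM htr ha) hord).
Qed.
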